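(* For any $T>0$, the derivative estimate $$\|u_x(\cdot,t)\|_B\le\mathcal{F}_t(f,u_0,u)\quad\text{for all }(f,u_0,u)\in\mathcal{I}_T,\ t\in(0,T],$$ is non-trivially sharp on $\bar D_T$; that is, there exists $\alpha>0$ such that $$\sup_{(f,u_0,u)\in\mathcal{I}_T^\alpha}\left(\inf_{t\in(0,T]}\left(\|u_x(\cdot,t)\|_B-\mathcal{F}_t(f,u_0,u)\right)\right)=0 .$$
   Context: For $\lambda>0$ let $D_\lambda=\mathbb{R}\times(0,\lambda]$, $\bar D_\lambda=\mathbb{R}\times[0,\lambda]$ and $\partial D=\mathbb{R}\times\{0\}$. $B_A^\lambda$ is the space of bounded continuous functions $u:\bar D_\lambda\to\mathbb{R}$. $B_B$ is the space of bounded continuous functions $\mathbb{R}\to\mathbb{R}$, with sup norm $\|v\|_B=\sup_{x\in\mathbb{R}}|v(x)|$. $\mathrm{BPC}^1(\mathbb{R})$ is the set of bounded, continuous functions $v:\mathbb{R}\to\mathbb{R}$ with piecewise continuous bounded derivative $v'$; $\|v'\|_B$ denotes the supremum of $|v'|$ (where $v'$ is defined). $\mathcal{A}_\lambda=\{(f,v,u): f\in C(\mathbb{R}),\ v\in \mathrm{BPC}^1(\mathbb{R}),\ u\in B_A^\lambda\}$, and $\mathcal{F}_\lambda:\mathcal{A}_\lambda\to[0,\infty)$ is $$\mathcal{F}_\lambda(f,v,u)=\|v'\|_B+\frac{1}{\sqrt{\pi}}\int_0^\lambda\frac{\|f(u(\cdot,\tau))\|_B}{(\lambda-\tau)^{1/2}}\,d\tau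 .$$ For $(f,v,u)\in\mathcal{A}_T$ and $0<t\le T$, $\mathcal{F}_t(f,v,u)$ means $\mathcal{F}_t(f,v,u|_{\bar D_t})$. For $T>0$, $f\in C(\mathbb{R})$, $u_0\in \mathrm{BPC}^1(\mathbb{R})$, a solution to [IVP] with $f$ and $u_0$ is a function $u:\bar D_T\to\mathbb{R}$ with $u\in C(\bar D_T)\cap C^{2,1}(D_T)\cap L^\infty(\bar D_T)$ ($C^{2,1}$: $u_t,u_x,u_{xx}$ exist and are continuous) such that $u_t-u_{xx}=f(u)$ on $D_T$ and $u=u_0$ on $\partial D$. $\mathcal{I}_T$ is the set of $(f,u_0,u)\in\mathcal{A}_T$ such that $u:\bar D_T\to\mathbb{R}$ is a solution to [IVP] with $f$ and $u_0$. For $\alpha>0$, $\mathcal{I}_T^\alpha=\{(f,u_0,u)\in\mathcal{I}_T:\ \|u_x(\cdot,T)\|_B\ge\alpha\}$. *)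

(* Defs.v *)
From HB Require Import structures.
From mathcomp Require Import all_boot all_order all_algebra.
From mathcomp Require Import all_classical all_reals all_analysis.

Set Implicit Arguments.
Unset Strict Implicit.
Unset Printing Implicit Defensive.

Import Order.TTheory GRing.Theory Num.Theory.
Import numFieldNormedType.Exports.

Local Open Scope classical_set_scope.
Local Open Scope ring_scope.

(* A function on the closed strip R x [0, T] is represented by a total function
   on R * R, of which only the values on the strip are ever used; restriction
   to a smaller strip therefore leaves the function unchanged. *)

Section Definitions.
Context {R : realType}.
Implicit Types (f v g : R -> R) (u w : R * R -> R) (A : set R).

Definition Dopen (l : R) : set (R * R) := [set p | 0 < p.2 <= l].
Definition Dbar (l : R) : set (R * R) := [set p | 0 <= p.2 <= l].

(* Sup norms take values in \bar R because the boundedness of u_x(., t) is not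
   part of the notion of solution. *)
Definition supnorm_on A g : \bar R := ereal_sup [set `|g x|%:E | x in A].
Definition supnorm g : \bar R := supnorm_on setT g.

Definition diff_points v : set R := [set x | derivable v x 1].

(* Piecewise continuity on R, for a function g defined on A: off a set S with
   finitely many points in each bounded interval, g is defined and continuous,
   and g has finite one-sided limits everywhere.  Near any point, only the point
   itself can lie in S, so values of g outside A do not affect these limits. *)
Definition piecewise_continuous A g :=
  exists S : set R,
    [/\ forall a b : R, finite_set (S `&` `[a, b]),
        forall x, ~ S x -> A x /\ {for x, continuous g}
      & forall x, cvg (g y @[y --> x^'-]) /\ cvg (g y @[y --> x^'+])].

Definition BPC1 v :=
  [/\ continuous v,
      [bounded v x | x in [set: R]],
      piecewise_continuous (diff_points v) (derive1 v)
    & [bounded derive1 v x | x in diff_points v]].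

Definition deriv_norm v : \bar R := supnorm_on (diff_points v) (derive1 v).

Definition BA (l : R) u :=
  {within Dbar l, continuous u} /\ [bounded u p | p in Dbar l].

Definition admissible (l : R) f v u := [/\ continuous f, BPC1 v & BA l u].

Definition Ffun (l : R) f v u : \bar R :=
  (deriv_norm v +
   (Num.sqrt pi)^-1%:E *
   \int[lebesgue_measure]_(tau in `[0%R, l[)
      (supnorm (fun x => f (u (x, tau))) * (Num.sqrt (l - tau))^-1%:E))%E.

Definition derivable_x w (p : R * R) := derivable (fun x => w (x, p.2)) p.1 1.
Definition dx w (p : R * R) : R := derive1 (fun x => w (x, p.2)) p.1.

(* u is only given up to time T, so the time derivative is the limit of the
   difference quotients over times in ]0, T]: two-sided for t < T, and the left
   derivative for t = T. *)
Definition quotient_t u (p : R * R) (s : R) : R :=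
  (u (p.1, s) - u p) / (s - p.2).
Definition derivable_t (T : R) u (p : R * R) :=
  cvg (quotient_t u p s @[s --> within `]0, T] (p.2)^']).
Definition dt (T : R) u (p : R * R) : R :=
  lim (quotient_t u p s @[s --> within `]0, T] (p.2)^']).

Definition C21 (T : R) u :=
  (forall p, Dopen T p ->
     [/\ derivable_t T u p, derivable_x u p & derivable_x (dx u) p]) /\
  [/\ {within Dopen T, continuous (dt T u)},
      {within Dopen T, continuous (dx u)}
    & {within Dopen T, continuous (dx (dx u))}].

Definition is_solution (T : R) f (u0 : R -> R) u :=
  [/\ {within Dbar T, continuous u} /\ [bounded u p | p in Dbar T],
      C21 T u,
      forall p, Dopen T p -> dt T u p - dx (dx u) p = f (u p)
    & forall x, u (x, 0) = u0 x].

Definition IT (T : R) : set ((R -> R) * (R -> R) * (R * R -> R)) :=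
  [set q | let: (f, u0, u) := q in
           admissible T f u0 u /\ is_solution T f u0 u].

Definition ux_norm u (t : R) : \bar R := supnorm (fun x => dx u (x, t)).

Definition ITalpha (T alpha : R) : set ((R -> R) * (R -> R) * (R * R -> R)) :=
  [set q | let: (f, u0, u) := q in
           IT T (f, u0, u) /\ (alpha%:E <= ux_norm u T)%E].

End Definitions.

(* Main.v *)
(* Reflecting u about a point c gives w(s, t) = u(c + s, t) - u(c - s, t), which
   vanishes at s = 0 and solves w_t = w_ss + g with |g| <= 2 sup |f(u)|.  On a
   bounded strip 0 <= s <= r the source is dominated by a step function of time,
   for which the half-line problem has an explicit solution: a superposition of
   shifts of a profile built from erfc, whose slope at s = 0 is 2 sqrt(t / pi).
   The maximum principle bounds w by this solution plus the linear function
   2 (sup |u0'| + sup |u| / r) s; comparing slopes at s = 0 and letting r tend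
   to infinity yields the derivative estimate.
   Sharpness: for f = 0 and u = exp(-k^2 t) sin(k x) / k the right-hand side is
   at most 1, and the left-hand side is at least exp(-k^2 T); let k tend to 0.
*)
Require Import Defs.
From HB Require Import structures.
From mathcomp Require Import all_boot all_order all_algebra.
From mathcomp Require Import all_classical all_reals all_analysis.
From mathcomp Require Import measurable_realfun ring lra.
Import Order.TTheory GRing.Theory Num.Theory.
Import numFieldNormedType.Exports.
Local Open Scope classical_set_scope.
Local Open Scope ring_scope.

Set Implicit Arguments.
Unset Strict Implicit.

(** * Maximum principle on a rectangle, with one-sided time derivatives *)

Section maximum_principle.
Context {R : realType}.
Implicit Types (g : R -> R) (v w : R * R -> R) (s t x d : R).

(** Reflection trades an interior derivative for a slope at the boundary, where any barrier that
    lies above [w] and vanishes with it at s = 0 bounds that slope. The slope of [w] is twice u_x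
    and its source is at most twice sup |f(u)|, so the factors 2 cancel. The obstacle is that [f] is
    merely continuous and its sup norm along u is taken over an unbounded line, so the argument
    avoids a representation formula with the source inside. On a compact rectangle f(u) is uniformly
    continuous: up to eps it is dominated by a step function of time whose values m_j stay below the
    sup norm. A step contributes 2 m_j (sqrt(t - tau_j) - sqrt(t - tau_{j+1})) / sqrt(pi) to the
    bound on u_x, which is m_j / sqrt(pi) times the integral of (t - s)^(-1/2) over that step. The
    barrier thus yields a lower sum of the very integral in [Ffun], with its exact constant. Cutting
    the half line at s = r leaves only |w| <= 2 sup |u| on the new edge; a linear term of slope
    proportional to 1 / r pays for this. *)

Definition is_derive2 g x d :=
  exists2 g1 : R -> R,
    (\forall y \near x, is_derive (y : R) 1 g (g1 y)) & is_derive x 1 g1 d.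

Definition is_left_dt v s t d :=
  (v (s, tau) - v (s, t)) / (tau - t) @[tau --> t^'-] --> d.

Lemma is_derive2_lin g1 g2 x d1 d2 k :
  is_derive2 g1 x d1 -> is_derive2 g2 x d2 ->
  is_derive2 (fun y => g1 y + k * g2 y) x (d1 + k * d2).
Proof.
move=> [h1 dh1 dd1] [h2 dh2 dd2]; exists (fun y => h1 y + k * h2 y).
  near=> y.
  have D1 : is_derive y 1 g1 (h1 y) by near: y.
  have D2 : is_derive y 1 g2 (h2 y) by near: y.
  by exact: is_derive_eq.
by exact: is_derive_eq.
Unshelve. all: by end_near. Qed.

Lemma is_left_dt_lin v w s t d1 d2 k :
  is_left_dt v s t d1 -> is_left_dt w s t d2 ->
  is_left_dt (fun p => v p + k * w p) s t (d1 + k * d2).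
Proof.
rewrite /is_left_dt => h1 h2.
apply: cvg_trans (cvgD h1 (cvgM (cvg_cst k) h2)).
apply: near_eq_cvg; near=> tau => /=.
have : tau - t != 0 by rewrite subr_eq0 lt_eqF//; near: tau; exact: nbhs_left_lt.
by rewrite !fctE /= => ?; field.
Unshelve. all: by end_near. Qed.

Lemma is_derive_left_dt v s t d :
  is_derive t 1 (fun tau => v (s, tau)) d -> is_left_dt v s t d.
Proof.
move=> /is_derive1_caratheodory[h [hE hc <-]].
have : h tau @[tau --> t^'-] --> h t by exact: cvg_at_left_filter.
apply: cvg_trans; apply: near_eq_cvg; near=> tau.
have tau0 : tau - t != 0
  by rewrite subr_eq0 lt_eqF//; near: tau; exact: nbhs_left_lt.
by rewrite hE mulfK.
Unshelve. all: by end_near. Qed.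

(** The first derivative [g1] vanishes at [x]. If [d] were positive, the slope function [h] of [g1]
    would be positive near [x], hence [g1] positive just to the right of [x], and the mean value
    theorem would give a value of [g] above the maximum. *)
Lemma is_derive2_at_max g x d :
  is_derive2 g x d -> (\forall y \near x, g y <= g x) -> d <= 0.
Proof.
move=> [g1 dg1 dd1] gmax.
have [e e0 He] : exists2 e : R, 0 < e & forall y, y \in `]x - e, x + e[ ->
    is_derive y 1 g (g1 y) /\ g y <= g x.
  have /nbhs_ballP[e /= e0 He] : \forall y \near x,
      is_derive (y : R) 1 g (g1 y) /\ g y <= g x.
    by near=> y; split; near: y.
  exists e => // y; rewrite in_itv/= => /andP[xy yx]; apply: He.
  by rewrite /ball/= ltr_distl; apply/andP; split; lra.
have xe : x \in `]x - e, x + e[ by rewrite in_itv/=; apply/andP; split; lra.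
have g1x0 : g1 x = 0.
  have /(@derive_val _ _ _ _ _ _ _) <- := (He x xe).1.
  have : is_derive x 1 g 0.
    apply: (@derive1_at_max _ g (x - e) (x + e)) => //; first lra.
    - by move=> t /He[[]].
    - by move=> t /He[].
  by move=> /(@derive_val _ _ _ _ _ _ _).
rewrite leNgt; apply/negP => d0.
move: dd1 => /is_derive1_caratheodory[h [hE hc hx]].
have /nbhs_ballP[e' /= e'0 He'] : \forall y \near x, 0 < h y.
  by have := cvgr_gt (h x) hc; apply; rewrite hx.
pose m := Num.min e e' / 2.
have m0 : 0 < m by rewrite divr_gt0// lt_min e0.
have me : m < e by rewrite ltr_pdivrMr// (@le_lt_trans _ _ e)// ?ge_min ?lexx//; lra.
have me' : m < e'.
  by rewrite ltr_pdivrMr// (@le_lt_trans _ _ e')// ?ge_min ?lexx ?orbT//; lra.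
have dg y : x <= y <= x + m -> is_derive y 1 g (g1 y).
  by move=> /andP[? ?]; apply: (He y _).1; rewrite in_itv/=; apply/andP; split; lra.
have [|||c] := @MVT _ g g1 x (x + m); first by lra.
- by move=> y; rewrite in_itv/= => /andP[? ?]; apply: dg; apply/andP; split; lra.
- apply: derivable_within_continuous => y; rewrite in_itv/= => /dg.
  by move=> /(@ex_derive _ _ _ _ _ _ _).
rewrite in_itv/= => /andP[xc cx] gE.
have : g (x + m) <= g x.
  by apply: (He _ _).2; rewrite in_itv/=; apply/andP; split; lra.
have : 0 < g1 c * (x + m - x).
  rewrite mulr_gt0//; last lra.
  have := hE c; rewrite g1x0 subr0 => ->.
  rewrite mulr_gt0 ?subr_gt0//; apply: He'.
  by rewrite /ball/= ltr_distl; apply/andP; split; lra.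
rewrite -gE; lra.
Unshelve. all: by end_near. Qed.

(* The time derivative is only required from the left, so that [v] may solve an
   equation whose right-hand side jumps in time. *)
Lemma parabolic_maximum_principle a t1 v :
  {within `[0, a] `*` `[0, t1], continuous v} ->
  (forall s t, 0 < s < a -> 0 < t <= t1 ->
     exists vt vss, [/\ is_left_dt v s t vt,
       is_derive2 (fun x => v (x, t)) s vss & vt < vss]) ->
  (forall t, 0 <= t <= t1 -> v (0, t) <= 0 /\ v (a, t) <= 0) ->
  (forall s, 0 <= s <= a -> v (s, 0) <= 0) ->
  forall s t, 0 <= s <= a -> 0 <= t <= t1 -> v (s, t) <= 0.
Proof.
move=> cv veq vlat vini s t sa tt1.
set Q := `[0, a] `*` `[0, t1].
have Qst : Q (s, t) by rewrite /Q/=; split; rewrite /= in_itv.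
have cQ : compact Q by apply: compact_setX; exact: segment_compact.
have [[s0 t0]] := compact_EVT_max (ex_intro _ _ Qst) cQ cv.
rewrite inE => -[/=]; rewrite !in_itv/= => s0a t0t1 vmax.
have {}vmax x tau : 0 <= x <= a -> 0 <= tau <= t1 -> v (x, tau) <= v (s0, t0).
  by move=> ? ?; apply: vmax; rewrite inE /Q/=; split; rewrite /= in_itv.
apply: (le_trans (vmax _ _ sa tt1)).
rewrite leNgt; apply/negP => v0.
have t00 : 0 < t0.
  rewrite lt_neqAle (andP t0t1).1 andbT; apply/eqP => t00.
  by move: v0; rewrite -t00 ltNge vini.
have s00 : 0 < s0.
  rewrite lt_neqAle (andP s0a).1 andbT; apply/eqP => s0E.
  by move: v0; rewrite -s0E ltNge (vlat _ t0t1).1.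
have s0a' : s0 < a.
  rewrite lt_neqAle (andP s0a).2 andbT; apply/eqP => s0E.
  by move: v0; rewrite s0E ltNge (vlat _ t0t1).2.
have [||vt [vss [dvt dvss]]] := veq s0 t0; [by rewrite s00|by rewrite t00 (andP t0t1).2|].
(* At this maximum [vss <= 0], and the left difference quotients force [0 <= vt], against the strict
   [vt < vss]. Only earlier times are compared, so [t0 = t1] is allowed. *)
apply/negP; rewrite -leNgt; apply: (@le_trans _ _ 0).
  apply: is_derive2_at_max dvss _; near=> y; apply: vmax => //.
  by apply/andP; split; apply/ltW; near: y; [exact: lt_nbhsr|exact: lt_nbhsl].
rewrite leNgt; apply/negP => vt0.
have quot_lt0 := cvgr_lt vt dvt _ vt0.
near (t0^'-) => tau.
have tau_lt : tau < t0 by near: tau; exact: nbhs_left_lt.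
have tau_gt : 0 < tau by near: tau; exact: nbhs_left_gt.
have : (v (s0, tau) - v (s0, t0)) / (tau - t0) < 0
  by near: tau; exact: quot_lt0.
apply/negP; rewrite -leNgt ler_ndivlMr ?subr_lt0// mul0r subr_le0.
apply: vmax => //; rewrite ltW//=; apply: (le_trans (ltW tau_lt)).
by case/andP: t0t1.
Unshelve. all: by end_near. Qed.
End maximum_principle.

(** * A primitive of the Gaussian and its limit at infinity *)

Section gauss_primitive.
Context {R : realType}.
Implicit Types (F f : R -> R) (a l x y z : R).

Lemma MVT_derive F f x y : x < y ->
  (forall z, x <= z <= y -> is_derive z 1 F (f z)) ->
  exists2 c, x < c < y & F y - F x = f c * (y - x).
Proof.
move=> xy dF; have [|||c] := @MVT _ F f x y => //.
- by move=> z; rewrite in_itv/= => /andP[? ?]; apply: dF; rewrite !ltW.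
- apply: derivable_within_continuous => z; rewrite in_itv/= => /dF.
  by move=> /(@ex_derive _ _ _ _ _ _ _).
by rewrite in_itv/=; exists c.
Qed.

Lemma derive_ge0_le F f x y : x <= y ->
  (forall z, x <= z <= y -> is_derive z 1 F (f z)) ->
  (forall z, x <= z <= y -> 0 <= f z) -> F x <= F y.
Proof.
rewrite le_eqVlt => /predU1P[->//|xy] dF f0.
have [c /andP[xc cy] FE] := MVT_derive xy dF.
by rewrite -subr_ge0 FE mulr_ge0// ?subr_ge0 ?(ltW xy)// f0// !ltW.
Qed.

Lemma derive_ge0_le_lim F f a l :
  (forall z, a <= z -> is_derive z 1 F (f z)) ->
  (forall z, a <= z -> 0 <= f z) -> F z @[z --> +oo] --> l -> F a <= l.
Proof.
move=> dF f0 Fl; have <- : lim (F z @[z --> +oo]) = l by exact/cvg_lim.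
apply: limr_ge; first by apply/cvg_ex; exists l.
near=> z; have az : a <= z by near: z; apply: nbhs_pinfty_ge; rewrite num_real.
by apply: (@derive_ge0_le F f) => // y /andP[ay _]; [exact: dF|exact: f0].
Unshelve. all: by end_near. Qed.

Lemma is_derive_gauss_fun z :
  is_derive z 1 (@gauss_fun R) (- 2 * z * gauss_fun z).
Proof.
rewrite /gauss_fun; apply: is_derive_eq.
by rewrite /GRing.scale/= ?expr1; ring.
Qed.

Lemma gauss_primitive : exists G : R -> R,
  [/\ G 0 = 0, forall z, -1 < z -> is_derive z 1 G (gauss_fun z)
    & G z @[z --> +oo] --> Num.sqrt pi / 2].
Proof.
pose mu := @lebesgue_measure R.
(* Integrating from -1 makes 0 an interior point, so that [G] has a two-sided derivative there; the
   boundary slope at s = 0 is read off at this point. *)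
pose G z := (\int[mu]_(x in `[-1, z]) gauss_fun x -
             \int[mu]_(x in `[-1, 0]) gauss_fun x)%R.
have int_gauss (A : set R) : measurable A -> mu.-integrable A (EFin \o gauss_fun).
  by move=> mA; apply: integrableS integrableT_gauss.
exists G; split; first by rewrite /G subrr.
- move=> z z1.
  have [||||dG GE] := @continuous_FTC1_closed R gauss_fun (-1) z (z + 1).
  + by rewrite ltrDl.
  + exact: int_gauss.
  + by [].
  + by move=> ?; exact: continuous_gauss_fun.
  rewrite /G -[gauss_fun z]subr0; apply: is_deriveB.
  by rewrite -GE derive1E; exact/derivableP.
(* The known limit pi / 4 is that of the square of the integral over [0, z]. *)
- have h : Num.sqrt (gauss_integral_proof.integral0_gauss z ^+ 2) @[z --> +oo]
      --> Num.sqrt (pi / 4 : R).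
    apply: continuous_cvg; first exact: sqrt_continuous.
    exact: gauss_integral_proof.cvg_integral0_gauss_sqr.
  have -> : Num.sqrt pi / 2 = Num.sqrt (pi / 4) :> R.
    rewrite sqrtrM ?pi_ge0// sqrtrV// (_ : 4 = 2 ^+ 2) ?sqrtr_sqr ?ger0_norm//.
    by rewrite expr2 -natrM.
  apply: cvg_trans h; apply: near_eq_cvg; near=> z.
  rewrite sqrtr_sqr ger0_norm ?gauss_integral_proof.integral0_gauss_ge0//.
  have z0 : 0 <= z by near: z; apply: nbhs_pinfty_ge; rewrite num_real.
  rewrite /G Rintegral_itvB ?bnd_simp//; last exact: int_gauss.
  by rewrite Rintegral_itv_obnd_cbnd//; exact: int_gauss.
Unshelve. all: by end_near. Qed.

End gauss_primitive.

(** * The self-similar profile of the half-line problem *)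

Section step_profile.
Context {R : realType}.
Implicit Types (x y z s r : R).

Lemma is_derive_comp_half (f : R -> R) x a :
  is_derive (x / 2) 1 f a -> is_derive x 1 (fun y => f (y / 2)) (a / 2).
Proof.
move=> df; apply: (@is_derive1_comp R f (fun y => y / 2) x a 2^-1) df _.
by apply: is_derive_eq; rewrite /GRing.scale/= ?mulr1 ?addr0; ring.
Qed.

(** Inserting r * h(s / sqrt r) into e_t - e_ss = 1 leaves the equation h - (z / 2) h' - h'' = 1,
    here split into h'' = - E and h - (z / 2) h' = 1 - E. The solution has E(z) = erfc(z / 2); [h1]
    and [1 - h] are its first and second iterated integrals from z to infinity. The bounds on [E]
    give monotonicity in time, those on [h] give sign and continuity at r = 0. *)
Lemma step_profile : exists h h1 E : R -> R,
  [/\ h 0 = 0 /\ h1 0 = 2 / Num.sqrt pi,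
      forall z, 0 <= z -> is_derive z 1 h (h1 z) /\ is_derive z 1 h1 (- E z),
      forall z, 0 <= z -> h z - z / 2 * h1 z = 1 - E z,
      forall z, 0 <= z -> 0 <= E z <= 1
    & forall z, 0 <= z -> 0 <= h z <= 2 / Num.sqrt pi * z].
Proof.
have [G [G0 dG Glim]] := @gauss_primitive R.
set p : R := Num.sqrt pi.
have p0 : 0 < p by rewrite sqrtr_gt0 pi_gt0.
have pn0 : p != 0 by rewrite gt_eqF.
pose g z := gauss_fun (z / 2).
have dg z : is_derive z 1 g (- (z / 2) * g z).
  apply: (is_derive_eq (is_derive_comp_half (is_derive_gauss_fun (z / 2)))).
  by rewrite /g; field.
have g_gt0 z : 0 < g z by exact: expR_gt0.
pose E z := 1 - 2 / p * G (z / 2).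
have dE z : 0 <= z -> is_derive z 1 E (- (g z / p)).
  move=> z0; have dG2 : is_derive (z / 2) 1 G (gauss_fun (z / 2)).
    by apply: dG; lra.
  have dc := is_derive_comp_half dG2.
  rewrite /E; apply: is_derive_eq; rewrite /GRing.scale/= /g.
  by field.
have half_cvg : z / 2 @[z --> +oo] --> (+oo : set_system R).
  by apply: gt0_cvgMly => //.
have E_lim : E z @[z --> +oo] --> 0.
  have -> : 0 = 1 - 2 / p * (p / 2) by field.
  apply: cvgB; first exact: cvg_cst.
  by apply: cvgM; [exact: cvg_cst|exact: cvg_comp half_cvg Glim].
have g_lim : g z @[z --> +oo] --> (0 : R).
  exact: cvg_comp half_cvg cvg_gauss_fun.
have E_ge0 z : 0 <= z -> 0 <= E z.
  move=> z0; rewrite -oppr_le0.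
  apply: (@derive_ge0_le_lim _ (fun y => - E y) (fun y => g y / p)).
  - move=> y zy; have dEy := dE y (le_trans z0 zy).
    by apply: is_derive_eq; rewrite opprK.
  - by move=> y _; rewrite ltW// divr_gt0.
  - by rewrite -[X in _ --> X]oppr0; exact: cvgN.
have E_le1 z : 0 <= z -> E z <= 1.
  move=> z0; have -> : 1 = E 0 by rewrite /E mul0r G0 mulr0 subr0.
  rewrite -lerN2; apply: (@derive_ge0_le _ (fun y => - E y) (fun y => g y / p) 0 z z0).
  - move=> y /andP[y0 _]; have dEy := dE y y0.
    by apply: is_derive_eq; rewrite opprK.
  - by move=> y _; rewrite ltW// divr_gt0.
pose h1 z := 2 / p * g z - z * E z.
pose h z := 1 - (1 + z ^+ 2 / 2) * E z + z / p * g z.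
have dh1 z : 0 <= z -> is_derive z 1 h1 (- E z).
  move=> z0; have dEz := dE z z0; have dgz := dg z.
  rewrite /h1; apply: is_derive_eq; rewrite /GRing.scale/=.
  by field.
have dh z : 0 <= z -> is_derive z 1 h (h1 z).
  move=> z0; have dEz := dE z z0; have dgz := dg z.
  rewrite /h; apply: is_derive_eq; rewrite /GRing.scale/= /h1.
  by field.
have h0 : h 0 = 0.
  rewrite /h /E !mul0r G0 mulr0 expr0n/=; ring.
have h10 : h1 0 = 2 / p.
  by rewrite /h1 mul0r subr0 /g mul0r /gauss_fun expr0n/= oppr0 expR0 mulr1.
(* Mills' bound: E - (2 / (p z)) g is nondecreasing beyond z and tends to 0. *)
have h1_ge0 z : 0 <= z -> 0 <= h1 z.
  rewrite le_eqVlt => /predU1P[<-|z0].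
    by rewrite h10 divr_ge0// ltW.
  have zn0 : z != 0 by rewrite gt_eqF.
  have : E z - 2 / (p * z) * g z <= 0.
    apply: (@derive_ge0_le_lim _ (fun y => E y - 2 / (p * z) * g y)
      (fun y => g y / (p * z) * (y - z))).
    - move=> y zy; have dEy := dE y (le_trans (ltW z0) zy); have dgy := dg y.
      by apply: is_derive_eq; rewrite /GRing.scale/=; field; apply/andP.
    - move=> y zy; rewrite mulr_ge0 ?subr_ge0//.
      by rewrite ltW// divr_gt0// mulr_gt0.
    - rewrite -[X in _ --> X]subr0 -[X in _ --> _ - X](mulr0 (2 / (p * z))).
      by apply: cvgB => //; apply: cvgM => //; exact: cvg_cst.
  have -> : h1 z = - (z * (E z - 2 / (p * z) * g z)).
    by rewrite /h1; field; apply/andP.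
  by move=> ?; rewrite oppr_ge0 pmulr_rle0.
have h1_le z : 0 <= z -> h1 z <= 2 / p.
  move=> z0; rewrite -h10 -lerN2.
  apply: (@derive_ge0_le _ (fun y => - h1 y) E 0 z z0).
  - move=> y /andP[y0 _]; have dy := dh1 y y0.
    by apply: is_derive_eq; rewrite opprK.
  - by move=> y /andP[y0 _]; exact: E_ge0.
exists h, h1, E; split; first exact: conj h0 h10.
- by move=> z z0; split; [exact: dh|exact: dh1].
- by move=> z z0; rewrite /h /h1; field.
- by move=> z z0; rewrite E_ge0// E_le1.
- move=> z z0; apply/andP; split.
    rewrite -h0; apply: (@derive_ge0_le _ h h1 0 z z0) => y /andP[y0 _].
      exact: dh.
    exact: h1_ge0.
  rewrite -subr_ge0 [leLHS](_ : 0 = 2 / p * 0 - h 0); last first.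
    by rewrite mulr0 h0 subr0.
  apply: (@derive_ge0_le _ (fun y => 2 / p * y - h y) (fun y => 2 / p - h1 y) 0 z z0).
  - move=> y /andP[y0 _]; have dy := dh y y0.
    by apply: is_derive_eq; rewrite /GRing.scale/= mulr1.
  - by move=> y /andP[y0 _]; rewrite subr_ge0 h1_le.
Qed.

End step_profile.

(** * Response of the half line to a unit source switched on at time 0 *)

Section step_response.
Context {R : realType}.
Implicit Types (s r : R).

Lemma is_left_dt_le0 (e : R * R -> R) s r :
  (forall s r, r <= 0 -> e (s, r) = 0) -> r <= 0 -> is_left_dt e s r 0.
Proof.
move=> e0 r0; rewrite /is_left_dt; apply: cvg_near_cst; near=> tau.
rewrite !e0 ?subrr ?mul0r//; apply: le_trans r0; apply/ltW.
by near: tau; exact: nbhs_left_lt.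
Unshelve. all: by end_near. Qed.

(* The solution of e_t - e_ss = 1 on the half line with zero initial and
   boundary values, extended by 0 to negative times. *)
Lemma step_response : exists e : R * R -> R,
  [/\ continuous e,
      forall s r, s = 0 \/ r <= 0 -> e (s, r) = 0,
      forall s r r', r <= r' -> e (s, r) <= e (s, r'),
      forall s r, 0 < s -> exists d1 d2, [/\ is_left_dt e s r d1,
        is_derive2 (fun x => e (x, r)) s d2 & d1 - d2 = (0 < r)%R%:R]
    & forall r, e (s, r) / s @[s --> 0^'+] --> 2 / Num.sqrt pi * Num.sqrt r].
Proof.
have [h [h1 [E [[h0 h10] dh hE E01 hle]]]] := @step_profile R.
set p : R := Num.sqrt pi in hle h10 *.
have p0 : 0 < p by rewrite sqrtr_gt0 pi_gt0.
(* For r <= 0 both [Num.sqrt r] and its inverse are 0, so the formula yields r * h 0 = 0 without a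
   case distinction. The absolute value keeps the argument of [h] in its domain z >= 0 for all s. *)
pose e (q : R * R) := q.2 * h (`|q.1| / Num.sqrt q.2).
have z_ge0 s r : 0 <= `|s| / Num.sqrt r by rewrite divr_ge0// sqrtr_ge0.
have e0 s r : s = 0 \/ r <= 0 -> e (s, r) = 0.
  move=> [->|r0]; rewrite /e /=; first by rewrite normr0 mul0r h0 mulr0.
  by rewrite ler0_sqrtr// invr0 mulr0 h0 mulr0.
have e_ge0 s r : 0 <= e (s, r).
  have [r0|r0] := leP r 0; first by rewrite e0//; right.
  by rewrite /e/= mulr_ge0// ?(ltW r0)//; case/andP: (hle _ (z_ge0 s r)).
(* As r decreases to 0 the argument of [h] may blow up; the linear bound on [h] still squeezes [e]
   to 0, which gives continuity on the line r = 0. *)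
have e_le s r : e (s, r) <= 2 / p * `|s| * Num.sqrt r.
  have [r0|r0] := leP r 0; first by rewrite e0 ?ler0_sqrtr ?mulr0//; right.
  have sr0 : Num.sqrt r != 0 by rewrite gt_eqF// sqrtr_gt0.
  have := hle _ (z_ge0 s r) => /andP[_ /(ler_wpM2l (ltW r0))].
  rewrite /e /= => /le_trans; apply.
  rewrite -{1}[r]sqr_sqrtr ?(ltW r0)//.
  by rewrite le_eqVlt; apply/orP; left; apply/eqP; field; rewrite sr0 gt_eqF.
have er s r : 0 < s -> 0 < r ->
    is_derive r 1 (fun tau => e (s, tau)) (1 - E (s / Num.sqrt r)).
  move=> s0 r0; have sr0 : 0 < Num.sqrt r by rewrite sqrtr_gt0.
  have z0 : 0 <= s / Num.sqrt r by rewrite divr_ge0 ?ltW.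
  have dsq := is_derive1_sqrt r0.
  have dV : is_derive r 1 (fun tau => s / Num.sqrt tau)
      (- s / (2 * Num.sqrt r ^+ 3)).
    have dsV := is_deriveV (lt0r_neq0 sr0) dsq.
    apply: is_derive_eq; rewrite /GRing.scale/=.
    by field; rewrite gt_eqF.
  have dc := @is_derive1_comp R h _ r _ _ (dh _ z0).1 dV.
  rewrite -hE// /e/= gtr0_norm//.
  have dc' : is_derive r 1 (fun tau => h (s / Num.sqrt tau))
    (h1 (s / Num.sqrt r) * (- s / (2 * Num.sqrt r ^+ 3))) by exact: dc.
  apply: is_derive_eq; rewrite /GRing.scale/=.
  rewrite -{1}[r]sqr_sqrtr ?(ltW r0)//.
  by field; rewrite gt_eqF.
exists e; split => //.
- move=> [s0 r0]; have [r00|r00] := leP r0 0.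
    rewrite /continuous_at e0; last by right.
    apply: (@squeeze_cvgr _ _ _ _ (fun=> 0)
      (fun q => 2 / p * `|q.1| * Num.sqrt q.2)).
    + by near=> q; rewrite (surjective_pairing q) e_ge0 e_le.
    + exact: cvg_cst.
    + have -> : 0 = 2 / p * `|s0| * Num.sqrt r0 by rewrite ler0_sqrtr// mulr0.
      apply: cvgM.
        apply: cvgM; first exact: cvg_cst.
        by apply: cvg_norm; exact: cvg_fst.
      by apply: (cvg_comp _ _ cvg_snd); exact: sqrt_continuous.
  apply: cvgM; first exact: cvg_snd.
  have hc : {for `|s0| / Num.sqrt r0, continuous h}.
    apply/differentiable_continuous/derivable1_diffP.
    by have [/(@ex_derive _ _ _ _ _ _ _)] := dh _ (z_ge0 s0 r0).
  apply: (cvg_comp (fun q : R * R => `|q.1| / Num.sqrt q.2) h); last exact: hc.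
  apply: cvgM; first by apply: cvg_norm; exact: cvg_fst.
  apply: cvgV; first by rewrite gt_eqF// sqrtr_gt0.
  by apply: (cvg_comp _ _ cvg_snd); exact: sqrt_continuous.
- move=> s r r' rr'; have [r0|r0] := leP r 0; first by rewrite e0//; right.
  have [->|sn0] := eqVneq s 0; first by rewrite !e0//; left.
  have eN tau : e (s, tau) = e (`|s|, tau) by rewrite /e/= normr_id.
  rewrite !eN; have s0 : 0 < `|s| by rewrite normr_gt0.
  apply: (@derive_ge0_le _ (fun tau => e (`|s|, tau))
    (fun tau => 1 - E (`|s| / Num.sqrt tau)) r r' rr') => tau /andP[r1 _].
    by apply: er => //; exact: lt_le_trans r1.
  by rewrite subr_ge0; case/andP: (E01 _ (z_ge0 s tau)).
- move=> s r s0; have [r0|r0] := leP r 0.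
    exists 0, 0; split; last by rewrite subrr.
      by apply: is_left_dt_le0 => // *; apply: e0; right.
    exists (fun=> 0).
      have -> : (fun x => e (x, r)) = cst 0.
        by apply/funext => x; rewrite e0//; right.
      by near=> y; exact: is_derive_cst.
    exact: is_derive_cst.
  have sr0 : 0 < Num.sqrt r by rewrite sqrtr_gt0.
  have dz y : is_derive (y : R) 1 (fun x => x / Num.sqrt r) (Num.sqrt r)^-1.
    by apply: is_derive_eq; rewrite /GRing.scale/= ?mulr1 ?addr0; ring.
  exists (1 - E (s / Num.sqrt r)), (- E (s / Num.sqrt r)); split.
  + by apply: is_derive_left_dt; exact: er.
  + exists (fun y => Num.sqrt r * h1 (y / Num.sqrt r)).
      near=> y; have y0 : 0 < y by near: y; exact: lt_nbhsr.
      have z0 : 0 <= y / Num.sqrt r by rewrite divr_ge0 ?ltW.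
      apply: (@near_eq_is_derive R R R (fun x => r * h (x / Num.sqrt r))
        (fun x => e (x, r)) y 1).
        near=> x; rewrite /e/= gtr0_norm//.
        by near: x; exact: lt_nbhsr.
      have dc : is_derive y 1 (fun x => h (x / Num.sqrt r)) _ :=
        @is_derive1_comp R h _ y _ _ (dh _ z0).1 (dz y).
      apply: is_derive_eq; rewrite /GRing.scale/=.
      rewrite -{1}[r]sqr_sqrtr ?(ltW r0)//.
      by field; rewrite gt_eqF.
    have z0 : 0 <= s / Num.sqrt r by rewrite divr_ge0 ?ltW.
    have dc : is_derive s 1 (fun x => h1 (x / Num.sqrt r)) _ :=
      @is_derive1_comp R h1 _ s _ _ (dh _ z0).2 (dz s).
    apply: is_derive_eq; rewrite /GRing.scale/=.
    by field; rewrite gt_eqF.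
  + by rewrite opprK subrK.
- move=> r; have [r0|r0] := leP r 0.
    rewrite ler0_sqrtr// mulr0; apply: cvg_near_cst; near=> s.
    by rewrite e0 ?mul0r//; right.
  have sr0 : 0 < Num.sqrt r by rewrite sqrtr_gt0.
  (* Since h 0 = 0, h(z) = z * k(z) with [k] continuous at 0 and k 0 = h1 0; hence e / s = sqrt r *
     k(s / sqrt r). *)
  have [k [kE kc k0]] := (is_derive1_caratheodory _ _ _).1 (dh 0 (lexx 0)).1.
  have : Num.sqrt r * k (s / Num.sqrt r) @[s --> 0^'+]
      --> Num.sqrt r * k (0 / Num.sqrt r).
    apply: cvgM; first exact: cvg_cst.
    apply: (cvg_comp (fun s => s / Num.sqrt r) k).
      apply: cvg_at_right_filter; apply: cvgM; first exact: cvg_id.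
      exact: cvg_cst.
    by rewrite mul0r; exact: kc.
  rewrite mul0r k0 h10 mulrC => kl.
  apply: cvg_trans kl; apply: near_eq_cvg; near=> s.
  have s0 : 0 < s by near: s; exact: nbhs_right_gt.
  have := kE (s / Num.sqrt r); rewrite h0 !subr0 => hkE.
  rewrite /e/= gtr0_norm// hkE.
  have rE := sqr_sqrtr (ltW r0).
  set q := Num.sqrt r in sr0 rE *; rewrite -rE.
  by field; rewrite !gt_eqF.
Unshelve. all: by end_near. Qed.

End step_response.

(** * Lipschitz bound for the initial datum *)

Section initial_slope.
Context {R : realType}.
Implicit Types (v g : R -> R) (A S : set R) (a b x M V : R).

Lemma le_supnorm_on A g x : A x -> (`|g x|%:E <= supnorm_on A g)%E.
Proof. by move=> Ax; apply: ereal_sup_ubound; exists x. Qed.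

Lemma supnorm_on_le A g (M : \bar R) :
  (forall x, A x -> (`|g x|%:E <= M)%E) -> (supnorm_on A g <= M)%E.
Proof. by move=> gM; apply: ge_ereal_sup => _ [x Ax <-]; exact: gM. Qed.

(** Induction on the length of [l]: an exceptional point strictly between [a] and [b] splits the
    interval, and each half needs one exception fewer. With none inside, the mean value theorem
    applies. *)
Lemma lipschitz_off_seq v V (l : seq R) a b : continuous v -> a <= b ->
  (forall x, a < x < b -> x \notin l -> derivable v x 1 /\ `|derive1 v x| <= V) ->
  `|v b - v a| <= V * (b - a).
Proof.
move=> cv; have [n ln] := ubnP (size l).
elim: n => // n IH in l ln a b *; move=> ab dv.
have [[p [pl pa pb]]|nol] := pselect (exists p, [/\ p \in l, a < p & p < b]).
  have ln' : (size (rem p l) < n)%N by rewrite size_rem//; case: l pl ln {dv}.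
  have sub x : x != p -> x \notin rem p l -> x \notin l.
    move=> xp; apply: contra => xl.
    by have := perm_mem (perm_to_rem pl) x; rewrite xl inE (negPf xp).
  have h1 : `|v p - v a| <= V * (p - a).
    apply: IH ln' _ _ (ltW pa) _ => x /andP[ax xp] xl.
    by apply: dv; [rewrite ax (lt_trans xp)|apply: sub xl; rewrite lt_eqF].
  have h2 : `|v b - v p| <= V * (b - p).
    apply: IH ln' _ _ (ltW pb) _ => x /andP[px xb] xl.
    by apply: dv; [rewrite xb (lt_trans pa)|apply: sub xl; rewrite gt_eqF].
  have -> : v b - v a = (v b - v p) + (v p - v a) by ring.
  by rewrite (le_trans (ler_normD _ _))//; lra.
move: ab; rewrite le_eqVlt => /predU1P[->|ab]; first by rewrite !subrr normr0 mulr0.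
have {}dv x : a < x < b -> derivable v x 1 /\ `|derive1 v x| <= V.
  move=> /[dup] xab /andP[ax xb]; apply: dv => //; apply/negP => xl.
  by apply: nol; exists x.
have [||c] := @MVT _ v (derive1 v) a b ab.
- by move=> x; rewrite in_itv/= => /dv[? _]; rewrite derive1E; exact/derivableP.
- exact: continuous_subspaceT.
rewrite in_itv/= => /dv[_ vc] ->.
by rewrite normrM (gtr0_norm (_ : 0 < b - a)) ?subr_gt0// ler_wpM2r// subr_ge0 ltW.
Qed.

Lemma BPC1_lipschitz v : BPC1 v -> exists V, [/\ 0 <= V, deriv_norm v = V%:E &
  forall a b, a <= b -> `|v b - v a| <= V * (b - a)].
Proof.
move=> [cv _ [S [Sfin Sdiff _]] [M [_ vM]]].
have dv_le : (deriv_norm v <= (M + 1)%:E)%E.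
  apply: supnorm_on_le => x dx; rewrite lee_fin.
  by apply: (vM (M + 1)) => //; rewrite ltrDl.
(* The supremum over an empty set would be -oo, so nonnegativity of [deriv_norm v] needs a point of
   differentiability. Without one, [S] would contain [0, 1], yet it is finite there. *)
have [x0 dx0] : exists x, diff_points v x.
  apply: contrapT => nod.
  have : lebesgue_measure (S `&` `[0, 1]) = 0%E :> \bar R.
    by apply: countable_lebesgue_measure0; exact/finite_set_countable.
  rewrite (_ : S `&` `[0, 1] = `[0, 1]%classic).
    rewrite lebesgue_measure_itv/= lte_fin ltr01 oppr0 adde0 => /eqP.
    by rewrite eqe oner_eq0.
  apply/setIidPr => x _; apply: contrapT => /Sdiff[dx _].
  by apply: nod; exists x.
have dv_ge0 : (0 <= deriv_norm v)%E.
  by apply: le_trans (le_supnorm_on _ dx0); rewrite lee_fin.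
have dv_fin : deriv_norm v \is a fin_num.
  by rewrite ge0_fin_numE// (le_lt_trans dv_le)// ltry.
exists (fine (deriv_norm v)); split; [exact: fine_ge0|by rewrite fineK|].
move=> a b ab; have /finite_seqP[l lE] := Sfin a b.
apply: (@lipschitz_off_seq _ _ l) => // x /andP[ax xb] xl.
have [|dx _] := Sdiff x.
  move=> Sx; move/negP: xl; apply.
  have : (S `&` `[a, b]) x by split => //=; rewrite in_itv/= !ltW.
  by rewrite lE.
by split => //; rewrite -lee_fin fineK//; exact: le_supnorm_on.
Qed.

End initial_slope.

(** * Lower sums of the singular time integral *)

Section integral_lower_bound.
Context {R : realType}.
Implicit Types (a b t x : R).
Local Notation mu := (@lebesgue_measure R).

(** The integral of a nonnegative function is a supremum over the simple functions below it, and
    this set grows with the function. It is applied to the sup norm of f(u) in time, about whose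
    measurability nothing is proved. *)
Lemma ge0_le_integral_nomeas d (T : measurableType d)
    (m : {measure set T -> \bar R}) (D : set T) (f1 f2 : T -> \bar R) :
  (forall y, D y -> 0 <= f1 y)%E -> (forall y, D y -> f1 y <= f2 y)%E ->
  (\int[m]_(y in D) f1 y <= \int[m]_(y in D) f2 y)%E.
Proof.
move=> f10 f12.
have f20 y : D y -> (0 <= f2 y)%E.
  by move=> Dy; exact: le_trans (f10 y Dy) (f12 y Dy).
rewrite !ge0_integralE//; apply: ereal_sup_le => _ [h hf1 <-]; exists h => //= y.
apply: le_trans (hf1 y) _; rewrite /patch; case: ifPn => //.
by rewrite inE => /f12.
Qed.

Lemma within_continuous_inv_sqrt a b x : b < x ->
  {within `[a, b], continuous (fun s => (Num.sqrt (x - s))^-1)}.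
Proof.
move=> bx; apply: continuous_in_subspaceT => s; rewrite inE/= in_itv/= => /andP[_ sb].
apply: cvgV; first by rewrite gt_eqF// sqrtr_gt0 subr_gt0 (le_lt_trans sb).
apply: (cvg_comp (fun s => x - s) Num.sqrt); last exact: sqrt_continuous.
by apply: cvgB; [exact: cvg_cst|exact: cvg_id].
Qed.

Lemma integral_inv_sqrt a b t x : a < b -> b < x ->
  (\int[mu]_(s in `[a, b]) ((Num.sqrt (x - s))^-1)%:E =
    (2 * (Num.sqrt (x - a) - Num.sqrt (x - b)))%:E)%E.
Proof.
move=> ab bx.
have dF s : s < x ->
    is_derive s 1 (fun s => - 2 * Num.sqrt (x - s)) (Num.sqrt (x - s))^-1.
  move=> sx; have xs : 0 < x - s by rewrite subr_gt0.
  have dx : is_derive s 1 (fun s => x - s) (-1).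
    by apply: is_derive_eq; rewrite /GRing.scale/=; ring.
  have dc : is_derive s 1 (fun s => Num.sqrt (x - s)) _ :=
    @is_derive1_comp R _ _ s _ _ (is_derive1_sqrt xs) dx.
  apply: is_derive_eq; rewrite /GRing.scale/=.
  by field; rewrite gt_eqF// sqrtr_gt0.
have cF s : s < x -> {for s, continuous (fun s => - 2 * Num.sqrt (x - s))}.
  move=> /dF/(@ex_derive _ _ _ _ _ _ _) ?.
  exact/differentiable_continuous/derivable1_diffP.
rewrite (@continuous_FTC2 _ _ (fun s => - 2 * Num.sqrt (x - s)))//.
- by rewrite -EFinB; congr EFin; ring.
- exact: within_continuous_inv_sqrt.
- split.
  + move=> s; rewrite in_itv/= => /andP[_ sb].
    by have /(@ex_derive _ _ _ _ _ _ _) := dF s (lt_trans sb bx).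
  + by apply: cvg_at_right_filter; apply: cF; exact: lt_trans bx.
  + by apply: cvg_at_left_filter; apply: cF.
- move=> s; rewrite in_itv/= => /andP[_ sb].
  by rewrite derive1E; have /(@derive_val _ _ _ _ _ _ _) := dF s (lt_trans sb bx).
Qed.

(** Each summand is [m j] times the integral of (t - s)^(-1/2) over a cell. The kernel is singular
    at s = t, so it is first replaced by the smaller kernel (t + d - s)^(-1/2), continuous on
    [0, t], whose integral is explicit; then d tends to 0. *)
Lemma integral_step_inv_sqrt (t : R) (n : nat) (tau m : nat -> R)
    (M : R -> \bar R) :
  (forall j, tau j < tau j.+1) -> tau 0 = 0 -> tau n = t ->
  (forall j, (j < n)%N -> 0 <= m j) ->
  (forall s, 0 <= s < t -> (0 <= M s)%E) ->
  (forall j s, (j < n)%N -> tau j <= s < tau j.+1 -> ((m j)%:E <= M s)%E) ->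
  ((\sum_(j < n)
     m j * (2 * (Num.sqrt (t - tau j) - Num.sqrt (t - tau j.+1))))%:E <=
   \int[mu]_(s in `[0%R, t[) (M s * (Num.sqrt (t - s))^-1%:E))%E.
Proof.
move=> tauS tau0 taun m0 M0 mM.
have tau_mono : {homo tau : i j / (i <= j)%N >-> i <= j}.
  by apply: homo_leq => // [? ? ?|j]; [exact: le_trans|exact: ltW].
set I := (X in (_ <= X)%E).
pose w (d s : R) : R := (Num.sqrt (t + d - s))^-1.
pose ell d (j : 'I_n) := ((fun s => (m j * w d s)%:E) \_ `[tau j, tau j.+1[%classic).
have tau_le_t (j : 'I_n) : tau j.+1 <= t by rewrite -taun; apply: tau_mono.
have w_ge0 d s : 0 <= w d s by rewrite invr_ge0 sqrtr_ge0.
have mw d (j : 'I_n) : 0 < d ->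
    measurable_fun `[tau j, tau j.+1] (EFin \o w d).
  move=> d0; apply: (measurable_int mu).
  apply: continuous_compact_integrable; first exact: segment_compact.
  apply: within_continuous_inv_sqrt.
  by rewrite (le_lt_trans (tau_le_t j))// ltrDl.
have mmw d (j : 'I_n) : 0 < d ->
    measurable_fun `[tau j, tau j.+1] (fun s => (m j * w d s)%:E).
  move=> d0; rewrite [X in measurable_fun _ X](_ : _ =
    (fun s => (m j)%:E * (EFin \o w d) s)%E)//.
  by apply: measurable_funeM; exact: mw.
have sub j : `[tau j, tau j.+1[ `<=` `[tau j, tau j.+1].
  by move=> s /=; rewrite !in_itv/= => /andP[-> /ltW].
have ell_ge0 d j s : (0 <= ell d j s)%E.
  by apply: erestrict_ge0 => x _; rewrite lee_fin mulr_ge0// m0.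
have int_ell d : 0 < d ->
    (\int[mu]_(s in `[0%R, t[) \sum_(j < n) ell d j s =
     (\sum_(j < n) m j *
       (2 * (Num.sqrt (t + d - tau j) - Num.sqrt (t + d - tau j.+1))))%:E)%E.
  move=> d0; rewrite ge0_integral_sum//; last first.
    move=> j; apply: measurable_funTS; apply/(measurable_restrictT _ _).1 => //.
    apply: (@measurable_funS _ _ _ _ `[tau j, tau j.+1]) => //.
    exact: mmw.
  rewrite -sumEFin; apply: eq_bigr => j _.
  rewrite -integral_mkcondr (_ : _ `&` _ = `[tau j, tau j.+1[%classic); last first.
    apply/setIidr => s /=; rewrite !in_itv/= => /andP[js sj]; apply/andP; split.
      by rewrite (le_trans _ js)// -tau0 tau_mono.
    exact: lt_le_trans (tau_le_t j).
  rewrite integral_itv_bndo_bndc; last first.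
    apply: (@measurable_funS _ _ _ _ `[tau j, tau j.+1]) => //.
    exact: mmw.
  under eq_integral do rewrite EFinM.
  rewrite ge0_integralZl_EFin//; last 3 first.
  - by move=> s _; rewrite lee_fin.
  - exact: mw.
  - exact: m0.
  rewrite integral_inv_sqrt ?EFinM// (le_lt_trans (tau_le_t j))// ltrDl.
  exact: d0.
(* The half-open cells are disjoint, so at most one summand is nonzero at [s]. *)
have ell_le d s : 0 < d -> 0 <= s < t ->
    (\sum_(j < n) ell d j s <= M s * (Num.sqrt (t - s))^-1%:E)%E.
  move=> d0 /[dup] st /andP[s0 s_lt].
  have f0 : (0 <= M s * (Num.sqrt (t - s))^-1%:E)%E.
    by rewrite mule_ge0 ?M0// lee_fin invr_ge0 sqrtr_ge0.
  have [[j js]|nos] := pselect (exists j : 'I_n, `[tau j, tau j.+1[%classic s);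
      last first.
    rewrite big1// => j _; rewrite /ell patchE ifF//; apply/negP.
    by rewrite inE => js; apply: nos; exists j.
  rewrite (bigD1 j)//= big1 ?adde0; last first.
    move=> i ij; rewrite /ell patchE ifF//; apply/negP; rewrite inE => is_.
    move: js is_; rewrite /= !in_itv/= => /andP[js sj] /andP[is_ si].
    move/negP: ij; apply; rewrite -val_eqE/= eqn_leq !(leqNgt (nat_of_ord _)).
    apply/andP; split; apply/negP => /tau_mono ?; lra.
  rewrite /ell patchE mem_set// EFinM; apply: lee_pmul.
  - by rewrite lee_fin m0.
  - by rewrite lee_fin.
  - by apply: mM => //; move: js; rewrite /= in_itv.
  - rewrite lee_fin /w lef_pV2 ?posrE ?sqrtr_gt0 ?ler_wsqrtr//; lra.
have I_ge d : 0 < d -> ((\sum_(j < n) m j *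
    (2 * (Num.sqrt (t + d - tau j) - Num.sqrt (t + d - tau j.+1))))%:E <= I)%E.
  move=> d0; rewrite -int_ell//; apply: ge0_le_integral_nomeas => s.
    by rewrite /= in_itv/= => st; rewrite sume_ge0.
  by rewrite /= in_itv/=; exact: ell_le.
pose B := \sum_(j < n) m j.
have B0 : 0 <= B by apply: sumr_ge0 => j _; exact: m0.
apply/lee_addgt0Pr => eps eps0.
(* With d = r ^ 2 each root moves by at most r, so the total loss is at most 2 r B <= eps. The added
   1 covers B = 0. *)
pose r := eps / (2 * B + 1).
have r0 : 0 < r by rewrite divr_gt0// ltr_wpDl// mulr_ge0.
have sr : Num.sqrt (r ^+ 2) = r by rewrite sqrtr_sqr gtr0_norm.
apply: le_trans (leeD2r _ (I_ge (r ^+ 2) (exprn_gt0 _ r0))).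
rewrite -EFinD lee_fin -lerBlDl -sumrB.
apply: (@le_trans _ _ (\sum_(j < n) m j * (2 * r))).
  apply: ler_sum => j _; rewrite -mulrBr ler_wpM2l ?m0//.
  rewrite -mulrBr ler_pM2l//.
  have h1 : Num.sqrt (t - tau j) <= Num.sqrt (t + r ^+ 2 - tau j).
    rewrite ler_wsqrtr//; have := sqr_ge0 r; lra.
  have h2 : Num.sqrt (t + r ^+ 2 - tau j.+1) <= Num.sqrt (t - tau j.+1) + r.
    have x0 : 0 <= t - tau j.+1 by rewrite subr_ge0.
    rewrite -(@ler_sqr _ _ (_ + _)) ?nnegrE ?addr_ge0 ?sqrtr_ge0 ?(ltW r0)//.
    rewrite sqrrD !sqr_sqrtr//; last by have := sqr_ge0 r; lra.
    have : 0 <= Num.sqrt (t - tau j.+1) * r by rewrite mulr_ge0 ?sqrtr_ge0 ?ltW.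
    lra.
  lra.
have B1 : 0 < 2 * B + 1 by rewrite ltr_wpDl// mulr_ge0.
rewrite -mulr_suml -/B /r [leLHS](_ : _ = eps * (2 * B) / (2 * B + 1)).
  by rewrite ler_pdivrMr// ler_pM2l// lerDl.
by field; rewrite gt_eqF.
Qed.

End integral_lower_bound.

(** * Superposition of shifted step responses *)

Section comparison.
Context {R : realType}.
Implicit Types (s t r c k d : R) (tau m : nat -> R).

Lemma compact_unif_continuous (F : R * R -> R) (K : set (R * R)) (eps : R) :
  compact K -> {within K, continuous F} -> 0 < eps ->
  exists2 d, 0 < d & forall p q, K p -> K q -> ball p d q -> `|F p - F q| < eps.
Proof.
move=> /compact_near_coveringP cK cF eps0.
have eps2 : 0 < eps / 2 by rewrite divr_gt0.
have H : \forall d \near 0^'+,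
    K `<=` (fun p => K p -> forall q, K q -> ball p d q -> `|F p - F q| < eps).
  apply: cK => x Kx.
  have := (subspace_continuousP _ _).1 cF x Kx => /cvgrPdist_lt /(_ _ eps2).
  rewrite /within /= => /nbhs_ballP[r /= r0 Hr].
  exists (ball x (r / 2), [set d | d < r / 2]) => /=.
    split; first by apply: nbhsx_ballx; rewrite divr_gt0.
    by apply: nbhs_right_lt; rewrite divr_gt0.
  move=> [p d] /= [xp dr] Kp q Kq pq.
  have := Hr p; have := Hr q.
  have xq : ball x r q.
    have -> : r = r / 2 + r / 2 by field.
    by apply: ball_triangle xp _; apply: le_ball pq; exact: ltW.
  have xp' : ball x r p by apply: le_ball xp; lra.
  move=> /(_ xq Kq) Hq /(_ xp' Kp) Hp.
  have -> : F p - F q = (F x - F q) - (F x - F p) by ring.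
  by apply: le_lt_trans (ler_normB _ _) _; lra.
near (0 : R)^'+ => d; exists d; first by near: d; exact: nbhs_right_gt.
by move=> p q Kp Kq; have : K `<=` (fun p => K p -> forall q, K q -> ball p d q ->
    `|F p - F q| < eps); [near: d|apply].
Unshelve. all: by end_near. Qed.

Lemma is_left_dt_shift (e : R * R -> R) s t c d :
  is_left_dt e s (t - c) d -> is_left_dt (fun p => e (p.1, p.2 - c)) s t d.
Proof.
move=> h; rewrite /is_left_dt /=.
have shift : (fun x => x - c) @ t^'- --> (t - c)^'-.
  move=> P [x /= x0 Px]; exists x => //= y ty yt.
  apply: Px => /=; last by rewrite ltrD2r.
  by rewrite (_ : t - c - (y - c) = t - y)//; ring.
apply: cvg_trans (cvg_comp _ _ shift h); apply: near_eq_cvg; near=> y => /=.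
by congr (_ / _); ring.
Unshelve. all: by end_near. Qed.

Lemma is_derive2_affine (a b x : R) : is_derive2 (fun y => a * y + b) x 0.
Proof.
exists (fun=> a); last exact: is_derive_cst.
by near=> y; apply: is_derive_eq; rewrite /GRing.scale/=; ring.
Unshelve. all: by end_near. Qed.

Lemma is_left_dt_affine (a b s t : R) :
  is_left_dt (fun p => a * p.1 + b * p.2) s t b.
Proof.
apply: is_derive_left_dt => /=.
by apply: is_derive_eq; rewrite /GRing.scale/=; ring.
Qed.

(** A difference of two shifts of [e] responds to a source switched on at [tau j] and off at
    [tau j.+1]; the rest is linearity. With left derivatives the source is active on left-open,
    right-closed cells, whence the strict inequalities in the indicators. *)
Lemma step_superposition (e : R * R -> R) tau m n :
  continuous e ->
  (forall s r, 0 < s -> exists d1 d2, [/\ is_left_dt e s r d1,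
     is_derive2 (fun x => e (x, r)) s d2 & d1 - d2 = (0 < r)%R%:R]) ->
  let Phi (p : R * R) :=
    \sum_(j < n) 2 * m j * (e (p.1, p.2 - tau j) - e (p.1, p.2 - tau j.+1)) in
  continuous Phi /\
  forall s t, 0 < s -> exists d1 d2, [/\ is_left_dt Phi s t d1,
     is_derive2 (fun x => Phi (x, t)) s d2
   & d1 - d2 = \sum_(j < n) 2 * m j * ((tau j < t)%R%:R - (tau j.+1 < t)%R%:R)].
Proof.
move=> ce de; elim: n => [|n [cPhi dPhi]] Phi.
  have -> : Phi = cst 0 by apply/funext => p; rewrite /Phi big_ord0.
  split; first exact: cst_continuous.
  move=> s t s0; exists 0, 0; split; last by rewrite big_ord0 subrr.
    by rewrite /is_left_dt; under eq_fun do rewrite /= subrr mul0r; exact: cvg_cst.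
  by exists (fun=> 0); [near=> y|]; exact: is_derive_cst.
set Phin := (fun p : R * R => \sum_(j < n) _) in cPhi dPhi.
have -> : Phi = fun p => Phin p + 2 * m n *
    (e (p.1, p.2 - tau n) + (-1) * e (p.1, p.2 - tau n.+1)).
  by apply/funext => p; rewrite /Phi big_ord_recr/= mulN1r.
split.
  move=> p; apply: cvgD; first exact: cPhi.
  apply: cvgM; first exact: cvg_cst.
  have cshift c : (fun p => e (p.1, p.2 - c)) @ p --> e (p.1, p.2 - c).
    apply: (cvg_comp (fun p : R * R => (p.1, p.2 - c)) e); last exact: ce.
    apply: (@cvg_pair _ _ _ (nbhs p) (nbhs p.1) (nbhs (p.2 - c)) _ _ _
      fst (fun q : R * R => q.2 - c)).
      exact: cvg_fst.
    by apply: cvgB; [exact: cvg_snd|exact: cvg_cst].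
  by apply: cvgD => //; apply: cvgM => //; exact: cvg_cst.
move=> s t s0.
have [d1 [d2 [h1 h2 h]]] := dPhi s t s0.
have [a1 [a2 [ha1 ha2 ha]]] := de s (t - tau n) s0.
have [b1 [b2 [hb1 hb2 hb]]] := de s (t - tau n.+1) s0.
exists (d1 + 2 * m n * (a1 + (-1) * b1)), (d2 + 2 * m n * (a2 + (-1) * b2)).
split.
- apply: is_left_dt_lin => //.
  by apply: (@is_left_dt_lin _ (fun p => e (p.1, p.2 - tau n))
    (fun p => e (p.1, p.2 - tau n.+1))); exact: is_left_dt_shift.
- apply: (@is_derive2_lin _ (fun x => Phin (x, t))) => //.
  exact: is_derive2_lin.
- rewrite big_ord_recr/= -h -(subr_gt0 (tau n)) -(subr_gt0 (tau n.+1)) -ha -hb.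
  by ring.
Unshelve. all: by end_near. Qed.

End comparison.

(** * The barrier on the half strip and its slope at the boundary *)

Section gradient_comparison.
Context {R : realType}.
Implicit Types (s t r c d : R) (tau m : nat -> R).

(** The two indicators of a summand cancel unless [t] lies in its cell, and exactly one left-open,
    right-closed cell contains [t]. *)
Lemma sum_step_indicator tau m n t :
  {homo tau : i j / (i <= j)%N >-> i <= j} -> tau 0 < t <= tau n ->
  exists k : nat, [/\ (k < n)%N, tau k < t <= tau k.+1 &
    \sum_(j < n) 2 * m j * ((tau j < t)%R%:R - (tau j.+1 < t)%R%:R) = 2 * m k].
Proof.
move=> tau_mono; elim: n => [|n IH] /andP[t0 tn].
  by move: t0; rewrite ltNge tn.
have [tn'|tn'] := leP t (tau n).
  have [|k [kn kt kE]] := IH; first by rewrite t0.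
  exists k; split=> //; first exact: leqW.
  rewrite big_ord_recr/= kE !ltNge tn' tn /=.
  by rewrite subrr mulr0 addr0.
exists n; split=> //; first by rewrite tn' tn.
rewrite big_ord_recr/= tn' ltNge tn/= subr0 mulr1 big1 ?add0r// => j _.
by rewrite !(le_lt_trans (tau_mono _ _ _) tn') ?subrr ?mulr0// ltnW.
Qed.

(** In the barrier, the superposition absorbs the source, the slope 2 V dominates the initial
    values, and 2 U / r lifts the linear term to at least 2 U on the edge s = r. *)
Lemma half_strip_comparison (e w : R * R -> R) tau m n r t (V U : R) :
  continuous e ->
  (forall s t, s = 0 \/ t <= 0 -> e (s, t) = 0) ->
  (forall s t t', t <= t' -> e (s, t) <= e (s, t')) ->
  (forall s t, 0 < s -> exists d1 d2, [/\ is_left_dt e s t d1,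
     is_derive2 (fun x => e (x, t)) s d2 & d1 - d2 = (0 < t)%R%:R]) ->
  {homo tau : i j / (i <= j)%N >-> i <= j} -> tau 0 = 0 -> tau n = t ->
  (forall j, (j < n)%N -> 0 <= m j) ->
  0 < r -> 0 <= V ->
  {within `[0, r] `*` `[0, t], continuous w} ->
  (forall x y j, 0 < x < r -> 0 < y <= t -> (j < n)%N -> tau j < y <= tau j.+1 ->
     exists d1 d2, [/\ is_left_dt w x y d1,
       is_derive2 (fun z => w (z, y)) x d2 & d1 - d2 <= 2 * m j]) ->
  (forall y, 0 <= y <= t -> w (0, y) = 0) ->
  (forall y, 0 <= y <= t -> w (r, y) <= 2 * U) ->
  (forall x, 0 <= x <= r -> w (x, 0) <= 2 * V * x) -> 0 <= U ->
  forall x, 0 <= x <= r -> w (x, t) <= (2 * V + 2 * U / r) * x +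
    \sum_(j < n) 2 * m j * (e (x, t - tau j) - e (x, t - tau j.+1)).
Proof.
move=> ce e0 e_mono de tau_mono tau0 taun m0 r0 V0 cw wE w0 wr wi U0 x xr.
have [cPhi dPhi] := @step_superposition _ e tau m n ce de.
set Phi := (fun p : R * R => \sum_(j < n) _) in cPhi dPhi.
have t0 : 0 <= t by rewrite -taun -tau0 tau_mono.
have Phi_ge0 p : 0 <= Phi p.
  apply: sumr_ge0 => j _; rewrite mulr_ge0 ?mulr_ge0 ?m0//.
  by rewrite subr_ge0 e_mono// lerB// tau_mono.
set K := 2 * V + 2 * U / r.
have K0 : 0 <= K by rewrite addr_ge0 ?mulr_ge0 ?invr_ge0// ltW.
apply/ler_addgt0Pr => eps eps0.
(* The term [et * p.2] provides the strict inequality that the maximum principle asks for, and it is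
   at most [eps] up to time [t]. *)
pose et := eps / (t + 1).
have et0 : 0 < et by rewrite divr_gt0// ltr_wpDl.
pose v p := w p + (-1) * (Phi p + 1 * (K * p.1 + et * p.2)).
have H : forall s y, 0 <= s <= r -> 0 <= y <= t -> v (s, y) <= 0.
  apply: parabolic_maximum_principle.
  - move=> p; apply: cvgD; first exact: cw.
    have : {within `[0, r] `*` `[0, t],
        continuous (fun p => (-1) * (Phi p + 1 * (K * p.1 + et * p.2)))}.
      apply: continuous_subspaceT => q.
      apply: cvgM; first exact: cvg_cst.
      apply: cvgD; first exact: cPhi.
      apply: cvgM; first exact: cvg_cst.
      apply: cvgD; apply: cvgM; try exact: cvg_cst.
        exact: cvg_fst.
      exact: cvg_snd.
    exact.
  - move=> s y sr /[dup] yt /andP[y0 y_le].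
    have [|k [kn ky kE]] := @sum_step_indicator tau m n y tau_mono.
      by rewrite tau0 taun yt.
    have [d1 [d2 [h1 h2 h]]] := wE s y k sr yt kn ky.
    have [|a1 [a2 [ha1 ha2 ha]]] := dPhi s y; first by case/andP: sr.
    exists (d1 + (-1) * (a1 + 1 * et)), (d2 + (-1) * (a2 + 1 * 0)); split.
    + do 2! apply: is_left_dt_lin => //; exact: is_left_dt_affine.
    + apply: (@is_derive2_lin _ (fun z => w (z, y))) => //.
      apply: (@is_derive2_lin _ (fun z => Phi (z, y))) => //.
      exact: (is_derive2_affine K (et * y) s).
    + by rewrite kE in ha; lra.
  - move=> y yt; rewrite /v/=; split.
      have := Phi_ge0 (0, y); have := mulr_ge0 (ltW et0) (andP yt).1.
      rewrite w0//; lra.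
    have := wr y yt; have := Phi_ge0 (r, y).
    have := mulr_ge0 (ltW et0) (andP yt).1; have := mulr_ge0 V0 (ltW r0).
    have -> : K * r = 2 * V * r + 2 * U by rewrite /K; field; rewrite gt_eqF.
    lra.
  - move=> s sr; rewrite /v/=.
    have := wi s sr; have := Phi_ge0 (s, 0).
    have : 0 <= 2 * U / r * s.
      by case/andP: sr => s0 _; rewrite mulr_ge0// ?divr_ge0 ?mulr_ge0// ltW.
    rewrite /K; lra.
have := H x t xr; rewrite t0 lexx => /(_ isT).
rewrite /v /=.
have : et * t <= eps.
  rewrite /et mulrAC ler_pdivrMr ?ltr_wpDl// ler_pM2l//; lra.
rewrite -/(Phi (x, t)) -[X in _ <= _ + X + _]/(Phi (x, t)); lra.
Qed.

(** [w] and its barrier both vanish at x = 0 at the final time, so dividing the comparison by x and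
    letting x decrease to 0 compares their slopes. [W] stands for a value of u_x up to sign, whence
    the slope [2 * W] of the reflected difference. *)
Lemma boundary_slope_bound (w : R * R -> R) tau m n r t (V U W : R) :
  {homo tau : i j / (i <= j)%N >-> i <= j} -> tau 0 = 0 -> tau n = t ->
  (forall j, (j < n)%N -> 0 <= m j) ->
  0 < r -> 0 <= V ->
  {within `[0, r] `*` `[0, t], continuous w} ->
  (forall x y j, 0 < x < r -> 0 < y <= t -> (j < n)%N -> tau j < y <= tau j.+1 ->
     exists d1 d2, [/\ is_left_dt w x y d1,
       is_derive2 (fun z => w (z, y)) x d2 & d1 - d2 <= 2 * m j]) ->
  (forall y, 0 <= y <= t -> w (0, y) = 0) ->
  (forall y, 0 <= y <= t -> w (r, y) <= 2 * U) ->
  (forall x, 0 <= x <= r -> w (x, 0) <= 2 * V * x) -> 0 <= U ->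
  is_derive (0 : R) 1 (fun x => w (x, t)) (2 * W) ->
  W <= V + U / r + (Num.sqrt pi)^-1 *
    \sum_(j < n) m j * (2 * (Num.sqrt (t - tau j) - Num.sqrt (t - tau j.+1))).
Proof.
move=> tau_mono tau0 taun m0 r0 V0 cw wE w0 wr wi U0 dw.
have [e [ce e0 e_mono de e_slope]] := @step_response R.
have t0 : 0 <= t by rewrite -taun -tau0 tau_mono.
have wle := half_strip_comparison ce e0 e_mono de tau_mono tau0 taun m0 r0 V0 cw
  wE w0 wr wi U0.
have p0 : 0 < Num.sqrt pi :> R by rewrite sqrtr_gt0 pi_gt0.
have lw : w (x, t) / x @[x --> 0^'+] --> 2 * W.
  have [h [hE hc <-]] := (is_derive1_caratheodory _ _ _).1 dw.
  have hl : h x @[x --> 0^'+] --> h 0 by exact: cvg_at_right_filter.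
  apply: cvg_trans hl; apply: near_eq_cvg; near=> x.
  have x0 : 0 < x by near: x; exact: nbhs_right_gt.
  have := hE x; rewrite w0 ?t0 ?lexx// !subr0 => ->.
  by rewrite mulfK// gt_eqF.
have le k : (k <= n)%N ->
  (\sum_(j < k) 2 * m j * (e (x, t - tau j) - e (x, t - tau j.+1))) / x
    @[x --> 0^'+] --> 2 * ((Num.sqrt pi)^-1 * \sum_(j < k) m j *
       (2 * (Num.sqrt (t - tau j) - Num.sqrt (t - tau j.+1)))).
  elim: k => [|k IH] kn.
    rewrite big_ord0 !mulr0; apply: cvg_near_cst; near=> x.
    by rewrite big_ord0 mul0r.
  have h : (\sum_(j < k) 2 * m j * (e (x, t - tau j) - e (x, t - tau j.+1))) / x +
      2 * m k * (e (x, t - tau k) / x - e (x, t - tau k.+1) / x) @[x --> 0^'+] -->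
    2 * ((Num.sqrt pi)^-1 *
    (\sum_(i < k) m i * (2 * (Num.sqrt (t - tau i) - Num.sqrt (t - tau i.+1))))) +
    2 * m k * (2 / Num.sqrt pi * Num.sqrt (t - tau k) -
               2 / Num.sqrt pi * Num.sqrt (t - tau k.+1)).
    apply: cvgD; first exact: IH (ltnW kn).
    by apply: cvgM; [exact: cvg_cst|exact: cvgB].
  rewrite big_ord_recr/=.
  have -> : 2 * ((Num.sqrt pi)^-1 *
    (\sum_(i < k) m i * (2 * (Num.sqrt (t - tau i) - Num.sqrt (t - tau i.+1))) +
     m k * (2 * (Num.sqrt (t - tau k) - Num.sqrt (t - tau k.+1))))) =
    2 * ((Num.sqrt pi)^-1 *
    (\sum_(i < k) m i * (2 * (Num.sqrt (t - tau i) - Num.sqrt (t - tau i.+1))))) +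
    2 * m k * (2 / Num.sqrt pi * Num.sqrt (t - tau k) -
               2 / Num.sqrt pi * Num.sqrt (t - tau k.+1)) by ring.
  apply: cvg_trans h; apply: near_eq_cvg; near=> x.
  by rewrite big_ord_recr/=; ring.
have lK : (2 * V + 2 * U / r) +
  (\sum_(j < n) 2 * m j * (e (x, t - tau j) - e (x, t - tau j.+1))) / x
    @[x --> 0^'+] --> (2 * V + 2 * U / r) + 2 * ((Num.sqrt pi)^-1 *
     \sum_(j < n) m j * (2 * (Num.sqrt (t - tau j) - Num.sqrt (t - tau j.+1)))).
  by apply: cvgD; [exact: cvg_cst|exact: le].
suff : 2 * W <= (2 * V + 2 * U / r) + 2 * ((Num.sqrt pi)^-1 *
    \sum_(j < n) m j * (2 * (Num.sqrt (t - tau j) - Num.sqrt (t - tau j.+1)))).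
  by move=> ?; lra.
have wc : cvg (w (x, t) / x @[x --> 0^'+]) by apply/cvg_ex; eexists; exact: lw.
rewrite -(cvg_lim (@Rhausdorff R) lw) -(cvg_lim (@Rhausdorff R) lK).
apply: ler_lim => //; first by apply/cvg_ex; eexists; exact: lK.
near=> x; have x0 : 0 < x by near: x; exact: nbhs_right_gt.
rewrite ler_pdivrMr// mulrDl divfK ?gt_eqF//; apply: wle.
by rewrite (ltW x0)/=; near: x; exact: nbhs_right_le.
Unshelve. all: by end_near. Qed.

End gradient_comparison.

(** * Regularity of solutions and step majorants of the source *)

Section gradient_estimate.
Context {R : realType}.
Implicit Types (f : R -> R) (u : R * R -> R) (T t x y c k : R).

Lemma within_continuous_comp (X Y Z : topologicalType) (g : X -> Y) (h : Y -> Z)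
    (A : set X) (B : set Y) :
  continuous g -> (forall a, A a -> B (g a)) -> {within B, continuous h} ->
  {within A, continuous (h \o g)}.
Proof.
move=> cg AB /subspace_continuousP ch; apply/subspace_continuousP => a Aa.
apply: (@cvg_comp _ _ _ g h (within A (nbhs a)) (within B (nbhs (g a)))
  (nbhs (h (g a))) _ (ch _ (AB _ Aa))) => P; rewrite /within/= => HP.
have H : nbhs a (fun z => B (g z) -> P (g z)) := cg a _ HP.
by apply: (filterS _ H) => z /= Hz /AB; exact: Hz.
Qed.

Lemma derivable_t_left_dt T u x y : derivable_t T u (x, y) -> 0 < y <= T ->
  is_left_dt u x y (dt T u (x, y)).
Proof.
move=> h /andP[y0 yT].
have sub : y^'- `=>` within `]0, T] y^'.
  move=> P; rewrite /at_left /dnbhs /within /= => HP; near=> z => zy.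
  have z0 : 0 < z by near: z; exact: lt_nbhsr.
  have : z != y -> `]0, T]%classic z -> P z by near: z; exact: HP.
  by apply; [rewrite lt_eqF|rewrite /= in_itv/= z0 (le_trans (ltW zy))].
exact: cvg_trans (cvg_app _ sub) h.
Unshelve. all: by end_near. Qed.

Lemma C21_left_dt T u x y : C21 T u -> 0 < y <= T ->
  is_left_dt u x y (dt T u (x, y)).
Proof.
move=> [du _] yT; have [h _ _] := du (x, y) yT.
exact: derivable_t_left_dt h yT.
Qed.

Lemma C21_is_derive_dx T u x y : C21 T u -> 0 < y <= T ->
  is_derive x 1 (fun z => u (z, y)) (dx u (x, y)) /\
  is_derive x 1 (fun z => dx u (z, y)) (dx (dx u) (x, y)).
Proof.
move=> [du _] yT; have [_ dux duxx] := du (x, y) yT.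
by split; rewrite [X in is_derive _ _ _ X]/dx derive1E; exact/derivableP.
Qed.

Lemma is_derive_comp_affine (g : R -> R) c k x d :
  is_derive (c + k * x) 1 g d -> is_derive x 1 (fun y => g (c + k * y)) (k * d).
Proof.
move=> dg; rewrite mulrC; apply: (@is_derive1_comp R g (fun y => c + k * y)) dg _.
by apply: is_derive_eq; rewrite /GRing.scale/=; ring.
Qed.

Lemma C21_is_derive2 T u c k x y : C21 T u -> 0 < y <= T ->
  is_derive2 (fun z => u (c + k * z, y)) x (k * k * dx (dx u) (c + k * x, y)).
Proof.
move=> du yT; exists (fun z => k * dx u (c + k * z, y)).
  near=> z; apply: (@is_derive_comp_affine (fun z => u (z, y))).
  exact: (C21_is_derive_dx _ du yT).1.
have d2 := @is_derive_comp_affine (fun z => dx u (z, y)) c k x _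
  (C21_is_derive_dx _ du yT).2.
by apply: is_derive_eq; rewrite /GRing.scale/=; ring.
Unshelve. all: by end_near. Qed.

Lemma exists_fine_partition t d : 0 < t -> 0 < d -> exists N : nat,
  (0 < N)%N /\ t / N%:R < d.
Proof.
move=> t0 d0; exists (Num.bound (t / d)).+1; split => //.
rewrite ltr_pdivrMr ?ltr0n// mulrC -ltr_pdivrMr//.
apply: (lt_trans (archi_boundP _)); first by rewrite divr_ge0// ltW.
by rewrite ltr_nat.
Qed.

(* The step function m dominates |f(u)| near the segment, and m - eps stays
   below the sup norm: this uses uniform continuity of f(u) on a compact only. *)
Lemma step_majorant (F : R * R -> R) a b t eps :
  a <= b -> 0 < t -> 0 < eps ->
  {within `[a, b] `*` `[0, t], continuous F} ->
  exists (n : nat) (tau m : nat -> R),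
  [/\ forall j, tau j < tau j.+1, tau 0 = 0, tau n = t, forall j, 0 <= m j &
   forall j, (j < n)%N ->
     (forall p, (`[a, b] `*` `[tau j, tau j.+1]) p -> `|F p| <= m j + eps) /\
     (forall s, tau j <= s <= tau j.+1 ->
       ((m j)%:E <= supnorm (fun x => F (x, s)))%E)].
Proof.
move=> ab t0 eps0 cF; set K := _ `*` _ in cF.
have cK : compact K by apply: compact_setX; exact: segment_compact.
have [d d0 Hd] := compact_unif_continuous cK cF eps0.
have [N [N0 tN]] := exists_fine_partition t0 d0.
pose tau (j : nat) := t * j%:R / N%:R.
have N0' : 0 < N%:R :> R by rewrite ltr0n.
have tauS j : tau j.+1 = tau j + t / N%:R.
  by rewrite /tau -natr1; field; rewrite gt_eqF.
have tau_lt j : tau j < tau j.+1 by rewrite tauS ltrDl divr_gt0.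
have tau_ge0 j : 0 <= tau j by rewrite /tau !mulr_ge0 ?invr_ge0// ltW.
have tau_le j : (j <= N)%N -> tau j <= t.
  by move=> jN; rewrite /tau ler_pdivrMr// ler_pM2l// ler_nat.
pose S j := `[a, b] `*` `[tau j, tau j.+1].
have SK j : (j < N)%N -> S j `<=` K.
  move=> jN [x s] [/= xab]; rewrite /= !in_itv/= => /andP[s1 s2]; split => //=.
  by rewrite in_itv/= (le_trans _ s1)//= (le_trans s2)// tau_le.
(* [P j] maximizes |F| on the j-th slab; beyond the partition the default (0, 0) serves. *)
have /choice[P HP] : forall j, exists p, (j < N)%N ->
    S j p /\ forall q, S j q -> `|F q| <= `|F p|.
  move=> j; have [jN|] := boolP (j < N)%N; last by exists (0, 0).
  have S0 : S j !=set0.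
    by exists (a, tau j); split => /=; rewrite in_itv/= lexx ?ab//= ltW.
  have cS : compact (S j) by apply: compact_setX; exact: segment_compact.
  have cFS : {within S j, continuous (fun p => `|F p|)}.
    move=> p; apply: cvg_norm; exact: continuous_subspaceW (SK j jN) cF p.
  have [p] := compact_EVT_max S0 cS cFS; rewrite inE => Sp Hp.
  by exists p => _; split => // q Sq; apply: Hp; rewrite inE.
(* The maximum is lowered by [eps] because it is attained at one time only: at any other time of the
   cell, the point with the same abscissa as [P j] has |F| larger than the lowered value. Truncation
   at 0 keeps the steps nonnegative. *)
exists N, tau, (fun j => Num.max (`|F (P j)| - eps) 0); split => //.
- by rewrite /tau mulr0 mul0r.
- by rewrite /tau mulfK// gt_eqF.
- by move=> j; rewrite le_max lexx orbT.
move=> j jN; have [SP maxP] := HP j jN; split.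
  move=> p Sp; apply: (le_trans (maxP p Sp)).
  by rewrite -lerBlDr le_max lexx.
move=> s s_in.
have F_le x : (`|F (x, s)|%:E <= supnorm (fun x => F (x, s)))%E.
  exact: (@le_supnorm_on _ setT (fun x => F (x, s)) x I).
rewrite EFin_max ge_max; apply/andP; split; last first.
  by apply: le_trans (F_le 0); rewrite lee_fin.
apply: le_trans (F_le (P j).1); rewrite lee_fin lerBlDr.
have Sq : S j ((P j).1, s) by case: SP => ? ?; split => //=; rewrite in_itv.
have : `|F (P j) - F ((P j).1, s)| < eps.
  apply: Hd; [exact: SK SP|exact: SK Sq|].
  split; first exact: ballxx.
  case: SP => _ /=; rewrite in_itv/= /ball/= ltr_distl => /andP[].
  move: s_in tN => /andP[]; rewrite tauS => *; apply/andP; split; lra.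
move=> /ltW h; rewrite -lerBlDl; apply: le_trans h; exact: lerB_dist.
Qed.

End gradient_estimate.

(** * The derivative estimate *)

Section derivative_estimate.
Context {R : realType}.
Implicit Types (f : R -> R) (u : R * R -> R) (T t x c k : R).

(** The sign [k] orients the reflection so that the slope of [w] at 0 is 2 k u_x(c, t); a one-sided
    barrier then controls |u_x|. *)
Lemma dx_bound_step T f (u0 : R -> R) u (V U eps r t c k : R) n (tau m : nat -> R) :
  is_solution T f u0 u -> 0 < t <= T -> 0 < r -> 0 <= V -> 0 <= U ->
  k = 1 \/ k = -1 ->
  (forall a b, a <= b -> `|u0 b - u0 a| <= V * (b - a)) ->
  (forall p, Dbar T p -> `|u p| <= U) ->
  (forall j, tau j < tau j.+1) -> tau 0 = 0 -> tau n = t ->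
  (forall j, 0 <= m j) -> 0 <= eps ->
  (forall j, (j < n)%N -> forall p,
     (`[c - r, c + r] `*` `[tau j, tau j.+1]) p -> `|f (u p)| <= m j + eps) ->
  k * dx u (c, t) <= V + U / r + (Num.sqrt pi)^-1 * (\sum_(j < n)
    m j * (2 * (Num.sqrt (t - tau j) - Num.sqrt (t - tau j.+1))) +
    eps * (2 * Num.sqrt t)).
Proof.
move=> [[cu _] du eqn ui] /andP[t0 tT] r0 V0 U0 kE lip uU tau_lt tau0 taun m0
  eps0 fm.
have tau_mono : {homo tau : i j / (i <= j)%N >-> i <= j}.
  by apply: homo_leq => // [? ? ?|j]; [exact: le_trans|exact: ltW].
pose w p := u (c + k * p.1, p.2) + (-1) * u (c + (- k) * p.1, p.2).
have kk : k * k = 1 by case: kE => ->; ring.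
have in_strip y : 0 <= y <= t -> forall x, Dbar T (x, y).
  by move=> /andP[y0 yt] x; rewrite /Dbar/= y0 (le_trans yt).
have cw : {within `[0, r] `*` `[0, t], continuous w}.
  have cshift l : {within `[0, r] `*` `[0, t],
      continuous (fun p => u (c + l * p.1, p.2))}.
    apply: (@within_continuous_comp _ _ _ (fun p : R * R => (c + l * p.1, p.2))
      u _ (Dbar T)) => //.
      move=> p; apply: (@cvg_pair _ _ _ (nbhs p) (nbhs (c + l * p.1)) (nbhs p.2)
        _ _ _ (fun q : R * R => c + l * q.1) snd); last exact: cvg_snd.
      apply: cvgD; first exact: cvg_cst.
      by apply: cvgM; [exact: cvg_cst|exact: cvg_fst].
    by move=> [x y] [_ /=]; rewrite in_itv/= => yt; exact: in_strip.
  move=> p; apply: cvgD; first exact: cshift.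
  by apply: cvgM; [exact: cvg_cst|exact: cshift].
(* The root differences telescope to sqrt t, so raising every step by [eps] costs eps * 2 sqrt t. *)
have -> : \sum_(j < n) m j * (2 * (Num.sqrt (t - tau j) - Num.sqrt (t - tau j.+1))) +
    eps * (2 * Num.sqrt t) = \sum_(j < n) (m j + eps) *
      (2 * (Num.sqrt (t - tau j) - Num.sqrt (t - tau j.+1))).
  have tel : \sum_(j < n) (Num.sqrt (t - tau j) - Num.sqrt (t - tau j.+1)) =
      Num.sqrt t.
    have := telescope_sumr (fun j => - Num.sqrt (t - tau j)) (leq0n n).
    rewrite big_mkord taun tau0 subrr subr0 sqrtr0 oppr0 opprK add0r => <-.
    by apply: eq_bigr => j _; ring.
  under [RHS]eq_bigr do rewrite mulrDl.
  by rewrite big_split/= -mulr_sumr -mulr_sumr tel.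
apply: (@boundary_slope_bound _ w tau (fun j => m j + eps)) => //.
- by move=> j _; rewrite addr_ge0.
- move=> x y j /andP[x0 xr] /andP[y0 yt] jn /andP[jy yj].
  have yT : 0 < y <= T by rewrite y0 (le_trans yt).
  exists (dt T u (c + k * x, y) + (-1) * dt T u (c + (- k) * x, y)),
    (k * k * dx (dx u) (c + k * x, y) +
     (-1) * (- k * - k * dx (dx u) (c + (- k) * x, y))); split.
  + apply: (@is_left_dt_lin _ (fun p => u (c + k * p.1, p.2))
      (fun p => u (c + (- k) * p.1, p.2))).
      exact: (@C21_left_dt _ T u (c + k * x) y du yT).
    exact: (@C21_left_dt _ T u (c + (- k) * x) y du yT).
  + apply: (@is_derive2_lin _ (fun z => u (c + k * z, y))
      (fun z => u (c + (- k) * z, y))); exact: (C21_is_derive2 _ _ _ du yT).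
  + have e1 := eqn (c + k * x, y) yT.
    have e2 := eqn (c + (- k) * x, y) yT.
    have slab l : l = 1 \/ l = -1 ->
        `|f (u (c + l * x, y))| <= m j + eps.
      move=> lE; apply: (fm j jn); split; rewrite /= in_itv/=; last first.
        by rewrite yj ltW.
      rewrite !lerD2l; apply/andP; move: lE; clear -x0 xr => -[->|->].
        by rewrite mul1r; split; lra.
      by rewrite mulN1r; split; lra.
    have s1 := slab k kE.
    have s2 : `|f (u (c + (- k) * x, y))| <= m j + eps.
      by apply: slab; case: kE => ->; [right|left; rewrite opprK].
    rewrite [leLHS](_ : _ = f (u (c + k * x, y)) - f (u (c + (- k) * x, y))).
      rewrite (le_trans (ler_norm _))// (le_trans (ler_normB _ _))//.
      by rewrite mulr2n mulrDl !mul1r lerD.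
    rewrite -e1 -e2 mulrNN kk.
    by move: (dt T u _) (dt T u _) (dx (dx u) _) (dx (dx u) _) => *; ring.
- by move=> y yt; rewrite /w/= !mulr0; ring.
- move=> y yt; rewrite /w/=.
  have := uU _ (in_strip _ yt (c + k * r)).
  have := uU _ (in_strip _ yt (c + (- k) * r)).
  by rewrite !ler_norml => /andP[? ?] /andP[? ?]; lra.
- move=> x /andP[x0 xr]; rewrite /w/= !ui.
  have : `|u0 (c + x) - u0 (c - x)| <= V * ((c + x) - (c - x)).
    by apply: lip; lra.
  have -> : V * ((c + x) - (c - x)) = 2 * V * x by ring.
  case: kE => ->; rewrite ?opprK !mul1r !mulN1r ler_norml => /andP[? ?]; lra.
- have tT' : 0 < t <= T by rewrite t0.
  have d1 l : is_derive (0 : R) 1 (fun x => u (c + l * x, t)) (l * dx u (c, t)).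
    apply: (@is_derive_comp_affine _ (fun z => u (z, t))).
    rewrite mulr0 addr0; exact: (C21_is_derive_dx _ du tT').1.
  have := d1 k; have := d1 (- k) => dN dP; rewrite /w/=.
  by apply: is_derive_eq; rewrite /GRing.scale/=; ring.
Qed.

(** The steps depend on the point [c] and on the width [r], but their lower sum is always below the
    same integral, because the sup norm is taken over the whole line. So the bound is uniform in
    [c]. *)
Lemma derivative_estimate T f (u0 : R -> R) u t : IT T (f, u0, u) -> 0 < t <= T ->
  (ux_norm u t <= Ffun t f u0 u)%E.
Proof.
move=> [[cf BPCu0 _] sol] /[dup] tT /andP[t0 t_le].
have [V [V0 VE lip]] := BPC1_lipschitz BPCu0.
have [[cu [M [_ uM]]] _ _ _] := sol.
(* Boundedness only provides bounds strictly above [M]; the maximum with 1 makes [U], and hence the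
   width [r], positive. *)
pose U := Num.max (M + 1) 1.
have U0 : 0 < U by rewrite lt_max ltr01 orbT.
have uU p : Dbar T p -> `|u p| <= U.
  by move=> Tp; apply: (uM U) => //; rewrite lt_max ltrDl ltr01.
apply: supnorm_on_le => c _; rewrite /Ffun VE.
apply/lee_addgt0Pr => eta eta0.
have p0 : 0 < Num.sqrt pi :> R by rewrite sqrtr_gt0 pi_gt0.
have st0 : 0 < Num.sqrt t by rewrite sqrtr_gt0.
(* This [r] makes the edge term U / r equal to eta / 2, and the [eps] below makes the step error eps
   * 2 sqrt t / sqrt pi equal to the other half. *)
pose r := 2 * U / eta.
have r0 : 0 < r by rewrite divr_gt0// mulr_gt0.
pose eps := eta * Num.sqrt pi / (4 * Num.sqrt t).
have eps0 : 0 < eps by rewrite divr_gt0// mulr_gt0.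
have cF : {within `[c - r, c + r] `*` `[0, t], continuous (f \o u)}.
  have sub : `[c - r, c + r] `*` `[0, t] `<=` Dbar T.
    move=> [x s] [_ /=]; rewrite in_itv/= => /andP[s0 st].
    by rewrite /Dbar/= s0 (le_trans st).
  apply: (continuous_subspaceW sub).
  by move=> p; apply: (continuous_comp (cu p)); exact: cf.
have [|n [tau [m [tau_lt tau0 taun m0 fm]]]] := step_majorant _ t0 eps0 cF.
  by lra.
have [k [kE kdx]] : exists k, (k = 1 \/ k = -1) /\ k * dx u (c, t) = `|dx u (c, t)|.
  have [h|h] := leP 0 (dx u (c, t)).
    by exists 1; rewrite mul1r ger0_norm//; split => //; left.
  by exists (-1); rewrite mulN1r ltr0_norm//; split => //; right.
have := dx_bound_step sol tT r0 V0 (ltW U0) kE lip uU tau_lt tau0 taun m0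
  (ltW eps0) (fun j jn => (fm j jn).1).
rewrite kdx; set S := \sum_(j < n) _ => dx_le.
have S_le : (S%:E <= \int[lebesgue_measure]_(s in `[0%R, t[)
    (supnorm (fun x => f (u (x, s))) * (Num.sqrt (t - s))^-1%:E))%E.
  apply: integral_step_inv_sqrt => //.
    move=> s _; apply: le_trans (@le_supnorm_on _ setT _ 0 I).
    by rewrite lee_fin.
  move=> j s jn /andP[js sj]; apply: (fm j jn).2.
  by rewrite js ltW.
apply: (@le_trans _ _ (V%:E + (Num.sqrt pi)^-1%:E * S%:E + eta%:E)%E).
  rewrite -EFinM -!EFinD lee_fin; apply: (le_trans dx_le).
  have -> : U / r = eta / 2 by rewrite /r; field; rewrite !gt_eqF.
  have -> : (Num.sqrt pi)^-1 * (S + eps * (2 * Num.sqrt t)) =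
      (Num.sqrt pi)^-1 * S + eta / 2.
    by rewrite /eps; field; rewrite !gt_eqF.
  lra.
apply: leeD2r; apply: leeD2l; apply: lee_wpmul2l => //.
Qed.

End derivative_estimate.

(** * Decaying waves of the heat equation *)

Section heat_wave.
Context {R : realType}.
Implicit Types (g : R -> R) (T t x y k eta : R).

(** The profile [g] is a parameter because space differentiation stays in this family: it replaces
    [g] by its derivative and multiplies by k. The profiles in use are [ksin k], [cos] and minus
    sine. *)
Definition wave k g (p : R * R) : R := expR (- (k ^+ 2 * p.2)) * g (k * p.1).

Lemma wave_continuous k g : continuous g -> continuous (wave k g).
Proof.
move=> cg p; apply: cvgM.
  apply: (cvg_comp (fun p : R * R => - (k ^+ 2 * p.2)) expR).
    by apply: cvgN; apply: cvgM; [exact: cvg_cst|exact: cvg_snd].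
  exact: continuous_expR.
apply: (cvg_comp (fun p : R * R => k * p.1) g); last exact: cg.
by apply: cvgM; [exact: cvg_cst|exact: cvg_fst].
Qed.

Lemma is_derive_wave_x k g g1 x t : (forall y, is_derive y 1 g (g1 y)) ->
  is_derive x 1 (fun z => wave k g (z, t)) (k * wave k g1 (x, t)).
Proof.
move=> dg; rewrite /wave/=.
have dg' : is_derive (0 + k * x) 1 g (g1 (k * x)) by rewrite add0r.
have dc := is_derive_comp_affine dg'.
have -> : (fun z => expR (- (k ^+ 2 * t)) * g (k * z)) =
    (fun z => expR (- (k ^+ 2 * t)) * g (0 + k * z)).
  by apply/funext => z; rewrite add0r.
by apply: is_derive_eq; rewrite /GRing.scale/=; ring.
Qed.

Lemma dx_wave k g g1 : (forall y, is_derive y 1 g (g1 y)) ->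
  dx (wave k g) = (fun p => k * wave k g1 p).
Proof.
move=> dg; apply/funext => -[x t].
by rewrite /dx derive1E; have [_ ->] := is_derive_wave_x k x t dg.
Qed.

Lemma is_derive_wave_t k g x t :
  is_derive t 1 (fun s => wave k g (x, s)) (- k ^+ 2 * wave k g (x, t)).
Proof.
rewrite /wave/=; apply: is_derive_eq; rewrite /GRing.scale/=.
by ring.
Qed.

Lemma wave_derivable_t T k g x t : derivable_t T (wave k g) (x, t).
Proof.
apply/cvg_ex; exists (- k ^+ 2 * wave k g (x, t)).
have [h [hE hc <-]] := (is_derive1_caratheodory _ _ _).1 (is_derive_wave_t k g x t).
have hl : h s @[s --> t^'] --> h t by move/continuous_withinNx : hc.
have hq : quotient_t (wave k g) (x, t) s @[s --> t^'] --> h t.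
  apply: cvg_trans hl; apply: near_eq_cvg; near=> s.
  rewrite /quotient_t/= hE mulfK// subr_eq0.
  by near: s; exact: nbhs_dnbhs_neq.
exact: cvg_trans (cvg_app _ (@cvg_within _ _ _ _)) hq.
Unshelve. all: by end_near. Qed.

Lemma dt_wave T k g x t : 0 < t <= T ->
  dt T (wave k g) (x, t) = - k ^+ 2 * wave k g (x, t).
Proof.
move=> tT; have h1 := derivable_t_left_dt (@wave_derivable_t T k g x t) tT.
have h2 := is_derive_left_dt (is_derive_wave_t k g x t).
exact: (cvg_unique _ h1 h2).
Qed.

(** Dividing by k cancels the factor k of the chain rule, so u_x has amplitude 1 at time 0 for every
    k. *)
Definition ksin k x : R := sin x / k.

Lemma is_derive_ksin k x : is_derive x 1 (ksin k) (cos x / k).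
Proof. by rewrite /ksin; apply: is_derive_eq; rewrite /GRing.scale/=; ring. Qed.

Lemma ksin_continuous k : continuous (ksin k).
Proof.
move=> x; apply: cvgM; [exact: continuous_sin|exact: cvg_cst].
Qed.

Lemma dx_wave_ksin k : k != 0 -> dx (wave k (ksin k)) = wave k cos.
Proof.
move=> k0; rewrite (dx_wave k (is_derive_ksin k)).
by apply/funext => p; rewrite /wave; field.
Qed.

Lemma wave_IT T k : 0 < k ->
  IT T ((fun=> 0), (fun x => ksin k (k * x)), wave k (ksin k)).
Proof.
move=> k0; have kn0 : k != 0 by rewrite gt_eqF.
have u_le p : 0 <= p.2 -> `|wave k (ksin k) p| <= k^-1.
  move=> p2; rewrite /wave /ksin normrM ger0_norm ?expR_ge0//.
  rewrite normrM [`|k^-1|]gtr0_norm ?invr_gt0// -[leRHS]mul1r.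
  rewrite -[leRHS]mul1r ler_pM ?expR_ge0 ?mulr_ge0 ?invr_ge0 ?(ltW k0)//.
    by rewrite -expR0 ler_expR oppr_le0 mulr_ge0 ?sqr_ge0.
  rewrite ler_pM2r ?invr_gt0//.
  by rewrite ler_norml sin_geN1 sin_le1.
have cu : continuous (wave k (ksin k)).
  exact: (@wave_continuous k _ (@ksin_continuous k)).
have ub : [bounded wave k (ksin k) p | p in Dbar T].
  exists k^-1; split; first exact: num_real.
  move=> M kM p /andP[p2 _]; exact: le_trans (u_le p p2) (ltW kM).
have dv x : is_derive x 1 (fun x => ksin k (k * x)) (cos (k * x)).
  have d1 : is_derive (0 + k * x) 1 (ksin k) (cos (k * x) / k).
    by rewrite add0r; exact: is_derive_ksin.
  have dc := is_derive_comp_affine d1.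
  have -> : (fun x => ksin k (k * x)) = (fun x => ksin k (0 + k * x)).
    by apply/funext => z; rewrite add0r.
  by apply: is_derive_eq; field.
have dvE : derive1 (fun x => ksin k (k * x)) = (fun x => cos (k * x)).
  by apply/funext => x; rewrite derive1E; have [_ ->] := dv x.
have ccos : continuous (fun x => cos (k * x)).
  move=> x; apply: (cvg_comp (fun x => k * x) cos); last exact: continuous_cos.
  by apply: cvgM; [exact: cvg_cst|exact: cvg_id].
have bpc : BPC1 (fun x => ksin k (k * x)).
  split.
  - move=> x; have [dvx _] := dv x.
    exact/differentiable_continuous/derivable1_diffP.
  - exists k^-1; split; first exact: num_real.
    move=> M kM x _; have := u_le (x, 0) (lexx 0).
    rewrite /wave/= mulr0 oppr0 expR0 mul1r => h.
    exact: le_trans h (ltW kM).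
  - exists set0; split; first by move=> a b; rewrite set0I; exact: finite_set0.
      move=> x _; split; first by have [dvx _] := dv x.
      by rewrite dvE; exact: ccos.
    move=> x; rewrite dvE; split; apply/cvg_ex; exists (cos (k * x)).
      by apply: cvg_at_left_filter; exact: ccos.
    by apply: cvg_at_right_filter; exact: ccos.
  - exists 1; split; first exact: num_real.
    move=> M M1 x _; rewrite dvE; apply: le_trans (ltW M1).
    by rewrite ler_norml cos_geN1 cos_le1.
have dxE := dx_wave_ksin kn0.
have dxxE := dx_wave k (@is_derive_cos R).
split.
  split => //; first exact: cst_continuous.
  by split => //; exact: continuous_subspaceT.
split.
- by split => //; exact: continuous_subspaceT.
- split.
    move=> [x t] _; split; first exact: wave_derivable_t.
      by have [] := is_derive_wave_x k x t (is_derive_ksin k).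
    by rewrite dxE; have [] := is_derive_wave_x k x t (@is_derive_cos R).
  have cxx : continuous (fun p => k * wave k (fun x => - sin x) p).
    move=> p; apply: cvgM; first exact: cvg_cst.
    by apply: wave_continuous => x; apply: cvgN; exact: continuous_sin.
  split.
  (* The formula for [dt] is available on the strip only, so continuity is transferred within it. *)
  + apply: (@subspace_eq_continuous _ _ _ (fun p => - k ^+ 2 * wave k (ksin k) p)).
      by move=> [x t]; rewrite inE => tT; rewrite /from_subspace dt_wave.
    apply: continuous_subspaceT => p.
    by apply: cvgM; [exact: cvg_cst|exact: cu].
  + rewrite dxE; apply: continuous_subspaceT.
    exact: (@wave_continuous k _ (@continuous_cos R)).
  + by rewrite dxE dxxE; exact: continuous_subspaceT.
- move=> [x t] tT; rewrite dt_wave// dxE dxxE /wave /ksin.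
  by field.
- by move=> x; rewrite /wave/= mulr0 oppr0 expR0 mul1r.
Qed.

Lemma ux_norm_wave_ge k t : k != 0 ->
  ((expR (- (k ^+ 2 * t)))%:E <= ux_norm (wave k (ksin k)) t)%E.
Proof.
move=> k0; apply: le_trans (@le_supnorm_on _ setT _ 0%R I).
by rewrite dx_wave_ksin// /wave/= mulr0 cos0 mulr1 ger0_norm// expR_ge0.
Qed.

Lemma Ffun_wave_le1 k t : k != 0 ->
  (Ffun t (fun=> 0%R) (fun x => ksin k (k * x)%R) (wave k (ksin k)) <= 1)%E.
Proof.
move=> k0; rewrite /Ffun integral0_eq; last first.
  move=> s _; rewrite (_ : supnorm _ = 0%E) ?mul0e//.
  apply/eqP; rewrite eq_le; apply/andP; split.
    by apply: supnorm_on_le => x _; rewrite normr0.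
  by apply: le_trans (@le_supnorm_on _ setT _ 0%R I); rewrite normr0.
rewrite mule0 adde0; apply: supnorm_on_le => x _; rewrite lee_fin.
have -> : derive1 (fun x => ksin k (k * x)) x = cos (k * x).
  have := dx_wave_ksin k0 => /(congr1 (fun F => F (x, 0))).
  rewrite /dx /wave/= mulr0 oppr0 expR0 mul1r => <-.
  by congr (derive1 _ x); apply/funext => z; rewrite mul1r.
by rewrite ler_norml cos_geN1 cos_le1.
Qed.

(** Choose k with k^2 T = eta and use exp(-eta) >= 1 - eta. *)
Lemma exists_slow_rate T eta : 0 < T -> 0 < eta ->
  exists2 k, 0 < k & 1 - eta <= expR (- (k ^+ 2 * T)).
Proof.
move=> T0 eta0; exists (Num.sqrt (eta / T)); first by rewrite sqrtr_gt0 divr_gt0.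
rewrite sqr_sqrtr; last by rewrite divr_ge0// ltW.
rewrite divfK ?gt_eqF//.
exact: expR_ge1Dx.
Qed.

End heat_wave.

(** * The estimate and its non-trivial sharpness *)

Unset Implicit Arguments.

Theorem corollary1p5 (R : realType) (T : R) (hT : 0 < T) :
  (forall (f u0 : R -> R) (u : R * R -> R), IT T (f, u0, u) ->
     forall t : R, 0 < t <= T -> (ux_norm u t <= Ffun t f u0 u)%E) /\
  (exists alpha : R, 0 < alpha /\
     ereal_sup [set (let: (f, u0, u) := q in
                     ereal_inf [set (ux_norm u t - Ffun t f u0 u)%E
                               | t in [set t : R | (0 < t <= T)%R]])
               | q in ITalpha T alpha] = 0%E).
Proof.
split; first by move=> f u0 u sol t tT; exact: derivative_estimate sol tT.
exists (1 / 2); split; first by rewrite divr_gt0.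
apply/eqP; rewrite eq_le; apply/andP; split.
  apply: ge_ereal_sup => _ [[[f u0] u] [sol _] <-].
  have TT : 0 < T <= T by rewrite hT lexx.
  (* The infimum is at most its value at t = T, which the estimate makes nonpositive. *)
  apply: (@le_trans _ _ (ux_norm u T - Ffun T f u0 u)%E).
    by apply: ereal_inf_lbound; exists T.
  by rewrite sube_le0; exact: derivative_estimate sol TT.
apply/lee_addgt0Pr => eta eta0.
(* The cap 1 / 2 keeps the slope of the wave at time T at least 1 - d >= alpha, which puts the wave
   in the restricted class. *)
pose d := Num.min eta (1 / 2).
have d0 : 0 < d by rewrite lt_min eta0 divr_gt0.
have [k k0 kd] := exists_slow_rate hT d0.
have kn0 : k != 0 by rewrite gt_eqF.
have d_eta : d <= eta by rewrite ge_min lexx.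
have d_half : d <= 1 / 2 by rewrite ge_min lexx orbT.
rewrite -leeBlDr// sub0e; apply: le_trans; last first.
  apply: ereal_sup_ubound.
  exists ((fun=> 0), (fun x => ksin k (k * x)), wave k (ksin k)) => //.
  split; first exact: wave_IT.
  by apply: le_trans (ux_norm_wave_ge T kn0); rewrite lee_fin; lra.
apply: le_ereal_inf_tmp => _ [t /andP[t0 tT] <-].
(* The decay is worst at t = T, so the single bound 1 - d at time T serves all t at once. *)
apply: (@le_trans _ _ ((expR (- (k ^+ 2 * t)))%:E - 1)%E).
  rewrite -EFinN -EFinB lee_fin.
  have : expR (- (k ^+ 2 * T)) <= expR (- (k ^+ 2 * t)).
    by rewrite ler_expR lerN2 ler_wpM2l// sqr_ge0.
  lra.
by apply: leeB; [exact: ux_norm_wave_ge|exact: Ffun_wave_le1].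
Qed.
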